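(* Let $n\ge 3$ and $\Gamma_n=\mathrm{SL}(n,\mathbb{Z})$. If $H$ is a finite index subgroup of $\Gamma_n$ specified by a finite generating set, then testing membership of any $g\in\Gamma_n$ in $H$ is decidable; that is, there is an algorithm which, given a finite subset of $\Gamma_n$ generating a subgroup $H$ of finite index in $\Gamma_n$ and given $g\in\Gamma_n$, terminates and decides whether $g\in H$.
   Context: The index of $H$ in $\Gamma_n$ is promised to be finite, but it is not part of the input. *)

(* Defs.v *)
From HB Require Import structures.
From mathcomp Require Import all_boot all_order all_algebra.
From mathcomp Require Import boolp classical_sets functions cardinality.

Set Implicit Arguments.
Unset Strict Implicit.
Unset Printing Implicit Defensive.

Import GRing.Theory.

Local Open Scope ring_scope.
Local Open Scope classical_set_scope.

Record SLZ (n : nat) := MkSLZ {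
  slz_val :> 'M[int]_n;
  slz_det : \det slz_val == 1 }.

HB.instance Definition _ (n : nat) := [isSub for @slz_val n].
HB.instance Definition _ (n : nat) := [Choice of SLZ n by <:].

Section SLZGroup.
Variable n : nat.
Implicit Types x y z : SLZ n.

Fact slz_unit x : (x : 'M_n) \in unitmx.
Proof. by rewrite unitmxE (eqP (slz_det x)) unitr1. Qed.

Fact slz_one_det : \det (1%:M : 'M[int]_n) == 1.
Proof. by rewrite det1. Qed.

Fact slz_mul_det x y : \det (slz_val x *m slz_val y) == 1.
Proof. by rewrite det_mulmx (eqP (slz_det x)) (eqP (slz_det y)) mulr1. Qed.

Fact slz_inv_det x : \det (invmx (slz_val x)) == 1.
Proof. by rewrite det_inv (eqP (slz_det x)) invr1. Qed.

Definition slz_one : SLZ n := MkSLZ slz_one_det.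
Definition slz_mul x y : SLZ n := MkSLZ (slz_mul_det x y).
Definition slz_inv x : SLZ n := MkSLZ (slz_inv_det x).

Fact slz_mulA : associative slz_mul.
Proof. by move=> x y z; apply: val_inj; rewrite /= mulmxA. Qed.

Fact slz_mul1 : left_id slz_one slz_mul.
Proof. by move=> x; apply: val_inj; rewrite /= mul1mx. Qed.

Fact slz_mulr1 : right_id slz_one slz_mul.
Proof. by move=> x; apply: val_inj; rewrite /= mulmx1. Qed.

Fact slz_mulV : left_inverse slz_one slz_inv slz_mul.
Proof. by move=> x; apply: val_inj; rewrite /= mulVmx ?slz_unit. Qed.

Fact slz_mulrV : right_inverse slz_one slz_inv slz_mul.
Proof. by move=> x; apply: val_inj; rewrite /= mulmxV ?slz_unit. Qed.

HB.instance Definition _ :=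
  isGroup.Build (SLZ n) slz_mulA slz_mul1 slz_mulr1 slz_mulV slz_mulrV.

End SLZGroup.

Section Subgroups.
Variable G : groupType.
Implicit Types H : set G.

Definition is_subgroup H : Prop :=
  [/\ H 1%g, (forall x y, H x -> H y -> H (x * y)%g)
    & (forall x, H x -> H (x^-1)%g)].

Definition generated (S : seq G) : set G := smallest is_subgroup [set` S].

Definition left_cosets H : set (set G) :=
  [set C | exists x : G, C = [set (x * h)%g | h in H]].

Definition finite_index H : Prop := finite_set (left_cosets H).

End Subgroups.

(* Kleene's partial recursive functions: [recfun k] is the syntax of the      *)
(* k-ary ones. In [RPrec f g] the recursion variable is the first argument,   *)
(* and g receives it followed by the previous value and the parameters.       *)
Inductive recfun : nat -> Type :=
| RZero : recfun 0
| RSucc : recfun 1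
| RProj k (i : 'I_k) : recfun k
| RComp k m (f : recfun m) (gs : 'I_m -> recfun k) : recfun k
| RPrec k (f : recfun k) (g : recfun k.+2) : recfun k.+1
| RMu k (f : recfun k.+1) : recfun k.

(* [computes f v y]: f is defined at v, with value y. In the [RPrec] case h   *)
(* lists the successive values of the recursion; in the [RMu] case f has to   *)
(* be defined and nonzero at all the arguments below y.                       *)
Fixpoint computes k (f : recfun k) : k.-tuple nat -> nat -> Prop :=
  match f in recfun k return k.-tuple nat -> nat -> Prop with
  | RZero => fun _ y => y = 0%N
  | RSucc => fun v y => y = (thead v).+1
  | RProj _ i => fun v y => y = tnth v i
  | RComp _ m f gs => fun v y => exists w : m.-tuple nat,
      (forall i, computes (gs i) v (tnth w i)) /\ computes f w y
  | RPrec k f g => fun v y => let p : k.-tuple nat := [tuple of behead v] in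
      exists h : nat -> nat,
      [/\ computes f p (h 0%N),
          (forall i, (i < thead v)%N ->
             computes g [tuple of i :: h i :: p] (h i.+1))
        & y = h (thead v)]
  | RMu _ f => fun v y => computes f [tuple of y :: v] 0%N /\
      (forall i, (i < y)%N ->
         exists z, computes f [tuple of i :: v] z.+1)
  end.

Lemma computes_functional k (f : recfun k) v y y' :
  computes f v y -> computes f v y' -> y = y'.
Proof.
elim: f v y y' => {k} /=.
- by move=> v y y' -> ->.
- by move=> v y y' -> ->.
- by move=> k i v y y' -> ->.
- move=> k m f IHf gs IHgs v y y' [w [gw fw]] [w' [gw' fw']].
  suff eqw : w = w' by rewrite -eqw in fw'; exact: IHf fw fw'.
  by apply: eq_from_tnth => i; exact: IHgs (gw i) (gw' i).
- move=> k f IHf g IHg v y y' [h [h0 hS ->]] [h' [h0' hS' ->]].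
  suff eqh i : (i <= thead v)%N -> h i = h' i by exact: eqh.
  elim: i => [_|i IHi lti]; first exact: IHf h0 h0'.
  have := hS' i lti; rewrite -(IHi (ltnW lti)).
  exact: IHg (hS i lti).
- move=> k f IHf v y y' [fy ly] [fy' ly'].
  case: (ltngtP y y') => // lt.
  + by have [z fz] := ly' _ lt; have := IHf _ _ _ fy fz.
  + by have [z fz] := ly _ lt; have := IHf _ _ _ fy' fz.
Qed.

Definition int_code (z : int) : nat :=
  match z with Posz k => k.*2 | Negz k => k.*2.+1 end.

(* A matrix is coded by the row-major list of its entries; [CodeSeq.code] is  *)
(* the library's (effective) bijection from lists of naturals to naturals.    *)
Definition mx_code n (A : 'M[int]_n) : nat :=
  CodeSeq.code [seq int_code (A i j) | i <- enum 'I_n, j <- enum 'I_n].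

Definition gens_code n (S : seq (SLZ n)) : nat :=
  CodeSeq.code [seq mx_code (slz_val A) | A <- S].

Lemma int_code_inj : injective int_code.
Proof.
move=> [a|a] [b|b] /= E; have := congr1 odd E;
  rewrite /= !odd_double //= => _; congr (_ _).
- exact: double_inj.
- by apply: double_inj; case: E.
Qed.

Lemma mx_code_inj n : injective (@mx_code n).
Proof.
move=> A B /(can_inj CodeSeq.codeK) E; apply/matrixP => i j.
apply: int_code_inj; move: E; rewrite /= => /eq_from_flatten_shape E.
have {}E : [seq [seq int_code (A i j) | j <- enum 'I_n] | i <- enum 'I_n] =
           [seq [seq int_code (B i j) | j <- enum 'I_n] | i <- enum 'I_n].
  by apply: E; rewrite /shape -!map_comp; apply: eq_map => k /=; rewrite !size_map.
move/eq_in_map: E => /(_ i (mem_enum _ i)).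
by move/eq_in_map => /(_ j (mem_enum _ j)).
Qed.

Lemma gens_code_inj n : injective (@gens_code n).
Proof.
move=> S T /(can_inj CodeSeq.codeK); apply: inj_map => A B /mx_code_inj.
exact: val_inj.
Qed.

(* Main.v *)
Require Import Defs.
From HB Require Import structures.
From mathcomp Require Import all_boot all_order all_algebra perm.
From mathcomp Require Import boolp classical_sets functions cardinality.
From mathcomp Require Import zify ring.

Set Implicit Arguments.
Unset Strict Implicit.
Unset Printing Implicit Defensive.

Import Order.TTheory GRing.Theory Num.Theory.

(* Membership in [H] is decided by searching for a certificate. A path of
   partial products witnesses [g] in [H]. For [g] outside [H], fix a finite
   presentation of SL(n,Z): a permutation action of the generators on a finite
   set that satisfies the finitely many relators extends to the whole group, so
   it is enough to exhibit such an action (on the cosets of [H]) in which the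
   generators of [H] fix a point that [g] moves.

   The presentation is obtained as in Silvester's theorem (Milnor, Introduction
   to algebraic K-theory, section 10). The generators are the elementary and the
   signed permutation matrices; the relators are all words of length at most 5
   with product 1. In a group satisfying the relators, follow the l1-norm of a
   fixed row along a word: at a local maximum the word can be rerouted through
   smaller rows by a short relation, so the row determines the coset modulo the
   lift of its stabilizer. The stabilizer is a group of translations extended by
   the same problem in one dimension less. *)

Local Open Scope ring_scope.

(** * Elementary and signed permutation matrices *)

(** The index is unknown, so nothing bounds the size of the table to be searched for, and the search
    meets tables of arbitrary origin. Whether such a table is an action of SL(n,Z) must be settled
    by finitely many equations; this is what forces a finite presentation. The finite index ensures
    that some certificate exists, hence that the search halts; soundness of both kinds of
    certificate makes the answer correct whichever is met. Taking all signed permutation matrices of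
    determinant 1 as generators puts the multiplication table of this finite group among the short
    relators, so its relations need not be derived from elementary matrices. The presented group is
    never constructed: the argument runs in any group over SL(n,Z) with lifts of the letters
    satisfying the relators, and is applied to the product of SL(n,Z) with a symmetric group.
    Lowering the dimension keeps the size of the matrices: level [k] uses the letters that touch
    only the coordinates from [k] on. *)

Definition sgb (e : bool) : int := if e then -1 else 1.

Lemma sgbM e f : sgb e * sgb f = sgb (e (+) f).
Proof. by case: e; case: f. Qed.

Section Letters.
Variable n : nat.
Implicit Types (A B : 'M[int]_n) (i j k l : 'I_n) (e f : bool).

Definition elem_mx i j e : 'M[int]_n := 1%:M + sgb e *: delta_mx i j.

Lemma det_elem_mx i j e : i != j -> \det (elem_mx i j e) == 1.
Proof.
have trig (a b : 'I_n) : (a < b)%N -> \det (elem_mx b a e) = 1.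
  move=> lt_ab; rewrite det_trig.
    rewrite big1 // => l _; rewrite !mxE eqxx.
    have /negPf -> : ~~ ((l == b) && (l == a)); last by rewrite mulr0 addr0.
    by apply/andP => -[/eqP eb /eqP ea]; rewrite -eb -ea ltnn in lt_ab.
  apply/is_trig_mxP => p q lt_pq; rewrite !mxE.
  have /negPf -> : p != q by rewrite neq_ltn lt_pq.
  have /negPf -> : ~~ ((p == b) && (q == a)); last by rewrite mulr0 addr0.
  by apply/andP => -[/eqP eb /eqP ea]; move: lt_pq; rewrite eb ea ltnNge ltnW.
rewrite neq_ltn => /orP[|/trig->//] /trig <-.
rewrite -det_tr; apply/eqP; congr (\det _); rewrite /elem_mx.
by rewrite linearD linearZ /= trmx1 trmx_delta.
Qed.

(** For [i = j] the matrix has determinant 2 or 0 and the value defaults to the identity, hence the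
    hypotheses [i != j] below. Acting on the right, it adds plus or minus column [i] to column
    [j]. *)
Definition elem i j e : SLZ n := insubd (slz_one n) (elem_mx i j e).

Lemma val_elem i j e : i != j -> slz_val (elem i j e) = elem_mx i j e.
Proof. by move=> /(det_elem_mx e) d; rewrite /elem insubdK. Qed.

Lemma mul_elem A i j e k l : i != j ->
  (A *m slz_val (elem i j e)) k l = A k l + sgb e * A k i *+ (l == j).
Proof.
move=> nij; rewrite val_elem // mulmxDr mulmx1 mxE -scalemxAr mxE; congr (_ + _).
rewrite -mulrnAr; congr (_ * _); rewrite mxE (bigD1 i) //= big1 => [|m /negPf nmi].
  by rewrite addr0 mxE eqxx /= mulr_natr.
by rewrite mxE nmi mulr0.
Qed.

Definition orth A := A *m A^T == 1%:M.

Definition signed_row A i j e := [forall l, A i l == sgb e *+ (l == j)].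

Lemma signed_rowE A i j e l : signed_row A i j e -> A i l = sgb e *+ (l == j).
Proof. by move=> /forallP/(_ l)/eqP. Qed.

Lemma signed_row_inj A i j e j' e' :
  signed_row A i j e -> signed_row A i j' e' -> j = j' /\ e = e'.
Proof.
move=> s s'; have := signed_rowE j s; rewrite (signed_rowE j s') eqxx.
by have [->|] := eqVneq j j'; [case: e {s}; case: e' {s'} | case: e {s}].
Qed.

(** The squares of the entries are natural numbers of sum 1, so one entry is 1 or -1 and the others
    vanish: orthogonal integer matrices are signed permutation matrices. *)
Lemma orth_row A i : orth A -> exists j e, signed_row A i j e.
Proof.
move=> /eqP/matrixP/(_ i i); rewrite !mxE eqxx /=.
under eq_bigr do rewrite mxE -expr2.
move=> sum1; have [j Aj] : exists j, A i j != 0.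
  apply/existsP; apply: contra_eqT sum1; rewrite negb_exists => /forallP z.
  by rewrite big1 // => j _; have := z j; rewrite negbK => /eqP ->; rewrite expr0n.
have sq0 l : 0 <= A i l ^+ 2 by exact: sqr_ge0.
have rest l : l != j -> A i l = 0 /\ A i j ^+ 2 = 1.
  move=> nlj; move: sum1; rewrite (bigD1 j) //= (bigD1 l) //=.
  set r := \sum_(_ | _) _; have r0 : 0 <= r by apply: sumr_ge0 => *.
  have := sq0 l; have : 1 <= A i j ^+ 2 by rewrite !expr2; nia.
  move=> *; have : A i l ^+ 2 = 0 by lia.
  by move/eqP; rewrite expf_eq0 => /eqP ->; split => //; lia.
have Aj1 : A i j ^+ 2 = 1.
  have [/existsP [l /rest[]] //|/existsPn no] := boolP [exists l, l != j].
  move: sum1; rewrite (bigD1 j) //= big1 ?addr0 // => l nlj.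
  by have := no l; rewrite nlj.
have /orP[/eqP v|/eqP v] : (A i j == 1) || (A i j == -1) by rewrite -sqrf_eq1 Aj1.
- exists j, false; apply/forallP => l.
  by have [->|/rest[->]] := eqVneq l j; rewrite ?v.
- exists j, true; apply/forallP => l.
  by have [->|/rest[->]] := eqVneq l j; rewrite ?v.
Qed.

Lemma orth_col A i j e l : orth A -> signed_row A i j e -> l != i -> A l j = 0.
Proof.
move=> /eqP/matrixP/(_ l i) + s nli; rewrite !mxE (negPf nli).
rewrite (bigD1 j) //= big1 => [|m /negPf nmj]; rewrite mxE (signed_rowE _ s).
  by rewrite eqxx addr0; case: e {s} => /=; lia.
by rewrite nmj mulr0.
Qed.

Lemma mul_orth A B i j e k : orth A -> signed_row A i j e ->
  (B *m A) k j = sgb e * B k i.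
Proof.
move=> oA s; rewrite mxE (bigD1 i) //= big1 => [|m nmi].
  by rewrite (signed_rowE _ s) eqxx addr0 mulrC.
by rewrite (orth_col oA s) ?mulr0.
Qed.

Lemma orth_tr A : orth A -> orth A^T.
Proof. by move=> /eqP/mulmx1C o; rewrite /orth trmxK o. Qed.

Lemma orth_row_onto A l : orth A -> exists p c, signed_row A p l c.
Proof.
move=> oA; have [p [c s]] := orth_row l (orth_tr oA).
exists p, c; have [j [e s']] := orth_row p oA.
have := signed_rowE p s; rewrite eqxx mxE (signed_rowE _ s').
have [-> E|_] := eqVneq l j; last by case: c {s}.
by move: s' E; case: e; case: c {s}.
Qed.

Lemma orth1 : orth (slz_one n).
Proof. by rewrite /orth /= trmx1 mulmx1. Qed.

Lemma orthM (x y : SLZ n) : orth x -> orth y -> orth (x * y)%g.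
Proof.
move=> /eqP ox /eqP oy; rewrite /orth /= trmx_mul mulmxA.
by rewrite -(mulmxA (slz_val x)) oy mulmx1 ox.
Qed.

Lemma orthV (x : SLZ n) : orth x -> orth (x^-1)%g.
Proof.
move=> ox; have /eqP o := ox; rewrite /= -[invmx _]mulmx1 -o mulmxA.
by rewrite mulVmx ?slz_unit // mul1mx orth_tr.
Qed.

Lemma elem_orth (w : SLZ n) i j e i' j' a b : i != j -> orth w ->
  signed_row w i i' a -> signed_row w j j' b ->
  i' != j' /\ (elem i j e * w = w * elem i' j' (e (+) a (+) b))%g.
Proof.
move=> nij ow si sj.
have nij' : i' != j'.
  apply/eqP => eij; rewrite -eij in sj; have nji : j != i by rewrite eq_sym.
  have := orth_col ow si nji.
  by rewrite (signed_rowE _ sj) eqxx; case: b {sj}.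
split=> //; apply/val_inj/matrixP => k l /=; rewrite mul_elem //.
have [p [c s]] := orth_row_onto l ow; rewrite (mul_orth _ _ ow s).
rewrite -[slz_val (elem i j e)]mul1mx mul_elem //.
rewrite -[slz_val w]mul1mx (mul_orth _ _ ow s) (mul_orth _ _ ow si).
have [lj|nlj] := eqVneq l j'.
  have pj : p = j.
    apply/eqP; apply: contraTT isT => npj; have := orth_col ow sj npj.
    by rewrite -lj (signed_rowE _ s) eqxx; case: c {s}.
  rewrite pj eqxx; rewrite pj lj in s; have [_ ->] := signed_row_inj s sj.
  by rewrite !mulr1n -!sgbM; case: a {si}; case: b {sj}; case: e; rewrite /=; ring.
have /negPf -> : p != j.
  by apply: contraNneq nlj => pj; rewrite pj in s; have [-> _] := signed_row_inj s sj.
by rewrite !mulr0n !addr0.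
Qed.

End Letters.

(** * Quarter turns, signed permutations fixing the initial rows, and the Euclidean step *)

Section Rotations.
Variable n : nat.
Implicit Types (A B : 'M[int]_n) (w x y : SLZ n) (i j k l : 'I_n) (e f : bool).

Lemma slz_mulE (x y : SLZ n) : slz_val (x * y)%g = slz_val x *m slz_val y.
Proof. by []. Qed.

(** The arbitrary left factor [A] lets [mul_elem] peel a product one letter at a time. *)
Lemma slz_inj (x y : SLZ n) :
  (forall A k l, (A *m slz_val x) k l = (A *m slz_val y) k l) -> x = y.
Proof.
move=> E; apply/val_inj/matrixP => k l /=.
by have := E 1%:M k l; rewrite !mul1mx.
Qed.

Lemma elemV i j e : i != j -> (elem i j e)^-1%g = elem i j (~~ e).
Proof.
move=> nij; apply: (mulgI (elem i j e)); rewrite mulgV; apply: slz_inj => A k l.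
rewrite slz_mulE mulmxA !mul_elem // mulmx1 (negPf nij) mulr0n addr0 -addrA -mulrnDl.
by rewrite -mulrDl; case: e; rewrite /= mul0r mul0rn addr0.
Qed.

(** The rotation by a quarter turn in the plane of [i] and [j]. Being also a signed permutation, it
    gives the relator of length 4 that ties the two kinds of letters together. *)
Definition qturn i j e : SLZ n := (elem i j e * elem j i (~~ e) * elem i j e)%g.

Lemma mul_qturn A i j e k l : i != j ->
  (A *m slz_val (qturn i j e)) k l =
  if l == j then sgb e * A k i else if l == i then - sgb e * A k j else A k l.
Proof.
move=> nij; have nji : j != i by rewrite eq_sym.
rewrite !slz_mulE !mulmxA !mul_elem // !eqxx (negPf nij).
have [->|] := eqVneq l j; first by rewrite ?(negPf nji); case: e => /=; lia.
by have [->|] := eqVneq l i; case: e => /=; lia.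
Qed.

Lemma qturn_row i j e : i != j -> signed_row (qturn i j e) i j e.
Proof.
move=> nij; apply/forallP => l; rewrite -[slz_val _]mul1mx mul_qturn // !mxE.
rewrite eqxx (negPf nij) (eq_sym i l).
by have [_|_] := eqVneq l j; have [_|_] := eqVneq l i; case: e.
Qed.

Lemma qturn_row_out i j e k : i != j -> k != i -> k != j ->
  signed_row (qturn i j e) k k false.
Proof.
move=> nij nki nkj; apply/forallP => l; rewrite -[slz_val _]mul1mx mul_qturn // !mxE.
rewrite (negPf nki) (negPf nkj) (eq_sym k l).
have [->|_] := eqVneq l j; first by rewrite mulr0 [j == k]eq_sym (negPf nkj).
have [->|//] := eqVneq l i; first by rewrite mulr0 [i == k]eq_sym (negPf nki).
Qed.

Lemma qturn_orth i j e : i != j -> orth (qturn i j e).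
Proof.
move=> nij; have nji : j != i by rewrite eq_sym.
apply/eqP/mulmx1C/matrixP => k l; rewrite mul_qturn // ![_^T _ _]mxE.
rewrite -[slz_val _]mul1mx !mul_qturn // !mxE !eqxx (negPf nij) ?(negPf nji).
rewrite (eq_sym i k) (eq_sym j k) (eq_sym l k).
have [->|nlj] := eqVneq l j.
  by case: (k == j); case: (k == i); case: e.
have [->|nli] := eqVneq l i.
  have [->|_] := eqVneq k j; first by rewrite (negPf nji); case: e.
  by case: (k == i); case: e.
have [->|_] := eqVneq k j; first by rewrite eq_sym (negPf nlj); case: e.
by have [->|//] := eqVneq k i; rewrite eq_sym (negPf nli); case: e.
Qed.

(** Orthogonality makes the first [m] columns trivial along with the first [m] rows: these are the
    signed permutations of the coordinates from [m] on. *)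
Definition wfix (m : nat) (w : SLZ n) :=
  orth w && [forall i : 'I_n, (i < m)%N ==> signed_row w i i false].

Lemma wfix_orth m w : wfix m w -> orth w.
Proof. by case/andP. Qed.

Lemma wfix_row m w i : wfix m w -> (i < m)%N -> signed_row w i i false.
Proof. by case/andP => _ /forallP/(_ i)/implyP. Qed.

Lemma wfix_le m w p l c : wfix m w -> signed_row w p l c -> (m <= l)%N = (m <= p)%N.
Proof.
move=> wm s; case: (leqP m p) => [le_mp|lt_pm]; last first.
  by have [<- _] := signed_row_inj (wfix_row wm lt_pm) s; rewrite leqNgt lt_pm.
suff : (m <= l)%N by [].
rewrite leqNgt; apply/negP => lt_lm.
have npl : p != l by apply: contraTneq le_mp => ->; rewrite -ltnNge.
have := orth_col (wfix_orth wm) (wfix_row wm lt_lm) npl.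
by rewrite (signed_rowE _ s) eqxx; case: c {s}.
Qed.

Lemma wfixP m w : orth w ->
  (forall i, (i < m)%N -> forall l, slz_val w i l = (i == l)%:R) -> wfix m w.
Proof.
move=> ow E; apply/andP; split=> //; apply/forallP => i; apply/implyP => lt_im.
by apply/forallP => l; rewrite E // [i == l]eq_sym.
Qed.

Lemma wfixE m w i l : wfix m w -> (i < m)%N -> slz_val w i l = (i == l)%:R.
Proof. by move=> wm lt_im; rewrite (signed_rowE _ (wfix_row wm lt_im)) eq_sym. Qed.

Lemma wfix1 m : wfix m 1%g.
Proof. by apply: wfixP => [|i _ l]; rewrite ?orth1 ?mxE. Qed.

Lemma mul_row_unit (x y : SLZ n) i l :
  (forall l, slz_val x i l = (i == l)%:R) -> slz_val (x * y)%g i l = slz_val y i l.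
Proof.
move=> E; rewrite /= mxE (bigD1 i) //= big1 => [|m nmi].
  by rewrite E eqxx mul1r addr0.
by rewrite E eq_sym (negPf nmi) mul0r.
Qed.

Lemma row_divg (x y : SLZ n) i l :
  (forall l, slz_val x i l = slz_val y i l) -> slz_val (x * y^-1)%g i l = (i == l)%:R.
Proof.
move=> E; transitivity (slz_val (y * y^-1)%g i l); last by rewrite mulgV /= mxE.
by rewrite /= !mxE; apply: eq_bigr => m _; rewrite E.
Qed.

Lemma wfixM m x y : wfix m x -> wfix m y -> wfix m (x * y)%g.
Proof.
move=> wx wy; apply: wfixP => [|i lt_im l]; first exact: orthM (wfix_orth wx) (wfix_orth wy).
by rewrite mul_row_unit => [|l']; rewrite ?(wfixE _ wx) ?(wfixE _ wy).
Qed.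

Lemma wfixV m x : wfix m x -> wfix m (x^-1)%g.
Proof.
move=> wx; apply: wfixP => [|i lt_im l]; first exact: orthV (wfix_orth wx).
rewrite -[(x^-1)%g]mul1g; apply: row_divg => l'.
by rewrite (wfixE _ wx) ?mxE.
Qed.

Lemma wfixW m m' x : (m <= m')%N -> wfix m' x -> wfix m x.
Proof.
move=> le wx; apply: wfixP => [|i lt_im l]; first exact: wfix_orth wx.
by rewrite (wfixE _ wx) // (leq_trans lt_im).
Qed.

Lemma wfix_qturn m (a b : 'I_n) f :
  (m <= a)%N -> (m <= b)%N -> a != b -> wfix m (qturn a b f).
Proof.
move=> ma mb nab; apply/andP; split; first exact: qturn_orth.
apply/forallP => r; apply/implyP => rm; apply: qturn_row_out => //.
  by apply: contraTneq rm => ->; rewrite -leqNgt.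
by apply: contraTneq rm => ->; rewrite -leqNgt.
Qed.

Lemma wfix_trans (k i : 'I_n) e : (k.+1 < n)%N -> (k <= i)%N ->
  exists2 w, wfix k w & signed_row w k i e.
Proof.
move=> ltkn leki.
have wturn := @wfix_qturn k.
have [eki|nki] := eqVneq k i; last by exists (qturn k i e); [apply: wturn | apply: qturn_row].
rewrite -{i}eki in leki *; case: e; last first.
  by exists 1%g; [apply: wfix1 | apply/forallP => l; rewrite /= mxE [_ == l]eq_sym].
(* Determinant 1 makes a second coordinate [b] change sign together with [k]: the square of a
   quarter turn is -1 on their plane. *)
pose b := Ordinal ltkn; have nkb : k != b by rewrite -val_eqE /= neq_ltn ltnSn.
exists (qturn k b false * qturn k b false)%g; first by apply: wfixM; apply: wturn => //=.
apply/forallP => l; rewrite /= -[_ *m _]mul1mx mulmxA !mul_qturn // !mxE.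
rewrite !eqxx (negPf nkb) [k == l]eq_sym.
have [->|nlb] := eqVneq l b; first by rewrite [b == k]eq_sym (negPf nkb).
by have [|] := eqVneq l k.
Qed.

(** Rows below [k] of the inverse are unit rows, so entry (k, k) of [A * A^-1] shows that the
    entries of row [k] in the columns from [k] on generate the unit ideal. Either two of them are
    nonzero and one reduces the other, or a single one is left; it is then 1 or -1, and it reduces
    any nonzero entry in a column before [k]. *)
Lemma euclid_row (k : 'I_n) (A : SLZ n) :
  (forall i l, (i < k)%N -> slz_val A i l = (i == l)%:R) ->
  (exists i e, (k <= i)%N /\ signed_row A k i e) \/
  exists i j e, [/\ (k <= i)%N, i != j, slz_val A k i != 0 &
    (absz (slz_val A k j + sgb e * slz_val A k i)%R + absz (slz_val A k i))%N =
    absz (slz_val A k j)].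
Proof.
move=> lowA; pose v := slz_val A k.
have step i j : (k <= i)%N -> i != j -> v i != 0 -> (absz (v i) <= absz (v j))%N ->
   exists i j e, [/\ (k <= i)%N, i != j, v i != 0 &
    (absz (v j + sgb e * v i)%R + absz (v i))%N = absz (v j)].
  move=> ki nij vi le; exists i, j.
  have [/existsP [e /eqP E]|/existsPn no] :=
    boolP [exists e, (absz (v j + sgb e * v i)%R + absz (v i))%N == absz (v j)].
    by exists e.
  by have := no true; have := no false; rewrite /sgb; lia.
pose B := (A^-1)%g; have lowB i l : (i < k)%N -> slz_val B i l = (i == l)%:R.
  by move=> ik; rewrite -[B]mul1g; apply: row_divg => m; rewrite lowA // mxE.
have AB i : (forall l, (k <= l)%N -> l != i -> v l = 0) -> (k <= i)%N -> v i * slz_val B i k = 1.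
  move=> z ki; have E : slz_val (A * B)%g k k = 1 by rewrite mulgV /= mxE eqxx.
  rewrite -[RHS]E slz_mulE [in RHS]mxE (bigD1 i) //= big1 ?addr0 // => l nli.
  have [lk|kl] := ltnP l k; last by rewrite -/(v l) z // mul0r.
  have /negPf nlk : l != k by rewrite -val_eqE /= neq_ltn lk.
  by rewrite (lowB l) // nlk mulr0.
have [/existsP[i /andP[ki vi]]|/existsPn no] :=
    boolP [exists i : 'I_n, (k <= i)%N && (v i != 0)]; last first.
  exfalso; have /(AB k)/(_ (leqnn _)) : forall l : 'I_n, (k <= l)%N -> l != k -> v l = 0.
    by move=> l kl _; have := no l; rewrite kl /= negbK => /eqP.
  by have := no k; rewrite leqnn /= negbK => /eqP ->; rewrite mul0r.
have [/existsP[j /and3P[kj nji vj]]|/existsPn no] :=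
    boolP [exists j : 'I_n, [&& (k <= j)%N, j != i & v j != 0]].
  by right; case: (leqP (absz (v i)) (absz (v j))) => [|/ltnW]; apply: step => //; rewrite eq_sym.
have /AB/(_ ki) : forall l : 'I_n, (k <= l)%N -> l != i -> v l = 0.
  by move=> l kl nli; have := no l; rewrite kl nli /= negbK => /eqP.
move=> /(congr1 absz); rewrite abszM => /eqP; rewrite muln_eq1 => /andP[/eqP vi1 _].
have [/existsP[j /andP[nji vj]]|/existsPn no'] := boolP [exists j : 'I_n, (j != i) && (v j != 0)].
  by right; apply: (step i j) => //; rewrite ?vi1 1?eq_sym // absz_gt0.
left; exists i, (v i == -1); split=> //; apply/forallP => l; rewrite -/(v l).
have [->|nli] := eqVneq l i; first by rewrite mulr1n /sgb; case: ifP; lia.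
by have := no' l; rewrite nli /= negbK mulr0n.
Qed.

End Rotations.

(** * A finite presentation of SL(n,Z) *)

Section Words.
Variable G : groupType.

Definition wprod (u : seq G) : G := foldr (fun x y => x * y)%g 1%g u.

Lemma wprod_cat u v : wprod (u ++ v) = (wprod u * wprod v)%g.
Proof. by elim: u => [|x u IHu] /=; rewrite ?mul1g // IHu mulgA. Qed.

Lemma wprod_rcons u x : wprod (rcons u x) = (wprod u * x)%g.
Proof. by rewrite -cats1 wprod_cat /= mulg1. Qed.

Definition winv (u : seq G) : seq G := rev [seq x^-1%g | x <- u].

Lemma wprod_inv u : wprod (winv u) = (wprod u)^-1%g.
Proof.
by rewrite /winv; elim: u => [|x u IHu] /=; rewrite ?invg1 // rev_cons wprod_rcons IHu invgM.
Qed.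

(** Letters are appended on the right, so that an induction follows the partial products of a word;
    for [L] closed under inverses this is the generated subgroup. *)
Inductive gen (L : G -> Prop) : G -> Prop :=
| gen1 : gen L 1%g
| genMr g x : gen L g -> L x -> gen L (g * x)%g.

Lemma gen_sub (L L' : G -> Prop) g : (forall x, L x -> L' x) -> gen L g -> gen L' g.
Proof. by move=> LL'; elim=> [|h x _ IH /LL' Lx]; [apply: gen1 | apply: genMr]. Qed.

Lemma gen_in (L : G -> Prop) x : L x -> gen L x.
Proof. by move=> Lx; rewrite -[x]mul1g; apply: genMr => //; apply: gen1. Qed.

Lemma genM (L : G -> Prop) g h : gen L g -> gen L h -> gen L (g * h)%g.
Proof.
move=> Lg; elim=> [|h' x _ IH Lx]; first by rewrite mulg1.
by rewrite mulgA; apply: genMr.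
Qed.

Lemma genV (L : G -> Prop) g : (forall x, L x -> L x^-1%g) -> gen L g -> gen L g^-1%g.
Proof.
move=> LV; elim=> [|h x _ IH /LV Lx]; first by rewrite invg1; apply: gen1.
by rewrite invgM; apply: genM => //; apply: gen_in.
Qed.

End Words.

Section Presentation.
Variable n : nat.

Definition letter (x : SLZ n) :=
  orth (slz_val x) || [exists i, exists j, exists e, (i != j) && (x == elem i j e)].

Lemma letter_elem i j e : i != j -> letter (elem i j e).
Proof.
move=> nij; apply/orP; right; apply/existsP; exists i; apply/existsP; exists j.
by apply/existsP; exists e; rewrite nij eqxx.
Qed.

Lemma letter_orth (x : SLZ n) : orth x -> letter x.
Proof. by rewrite /letter => ->. Qed.

Lemma letterV (x : SLZ n) : letter x -> letter x^-1%g.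
Proof.
case/orP => [/orthV|/existsP[i] /existsP[j] /existsP[e] /andP[nij /eqP ->]].
  exact: letter_orth.
by rewrite elemV //; apply: letter_elem.
Qed.

Variables (P : groupType) (pi : P -> SLZ n) (lift : SLZ n -> P).
Hypothesis piM : forall g h, pi (g * h)%g = (pi g * pi h)%g.
Hypothesis pi_lift : forall x, letter x -> pi (lift x) = x.
(* The longest relation used below, [X_chain], has length 5. *)
Hypothesis short : forall u, all letter u -> (size u <= 5)%N ->
  wprod u = 1%g -> wprod (map lift u) = 1%g.

Implicit Types (i j l r : 'I_n) (e f : bool) (g h s x : P).

Lemma pi1 : pi 1%g = 1%g.
Proof. by apply: (mulgI (pi 1%g)); rewrite -piM !mulg1. Qed.

Lemma liftV (x : SLZ n) : letter x -> lift x^-1%g = (lift x)^-1%g.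
Proof.
move=> lx; apply: (mulgI (lift x)); rewrite mulgV.
have := short (u := [:: x; x^-1%g]); rewrite /= !mulg1 mulgV lx letterV //.
by apply.
Qed.

Lemma lift_rel u v : all letter u -> all letter v -> (size u + size v <= 5)%N ->
  wprod u = wprod v -> wprod (map lift u) = wprod (map lift v).
Proof.
move=> lu lv sz E; apply: (mulIg (wprod (map lift v))^-1%g); rewrite mulgV.
have Ev : map lift (winv v) = winv (map lift v).
  rewrite /winv map_rev; congr rev; rewrite -!map_comp.
  by apply/eq_in_map => x /(allP lv) lx /=; rewrite liftV.
rewrite -wprod_inv -Ev -wprod_cat -map_cat; apply: short.
- rewrite all_cat lu /= /winv all_rev all_map.
  by apply/allP => x /(allP lv) /letterV.
- by rewrite size_cat /winv size_rev size_map.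
- by rewrite wprod_cat wprod_inv E mulgV.
Qed.

Definition X i j e : P := lift (elem i j e).

Lemma XV i j e : i != j -> X i j (~~ e) = (X i j e)^-1%g.
Proof. by move=> nij; rewrite -liftV ?letter_elem // elemV. Qed.

Lemma lift_orthM (x y : SLZ n) : orth x -> orth y -> lift (x * y)%g = (lift x * lift y)%g.
Proof.
move=> ox oy; have := lift_rel (u := [:: x * y]%g) (v := [:: x; y]).
by rewrite /= !mulg1 !letter_orth //; [apply | exact: orthM].
Qed.

Lemma X_orth i j e w i' j' a b : i != j -> orth (slz_val w) ->
  signed_row w i i' a -> signed_row w j j' b ->
  i' != j' /\ (X i j e * lift w = lift w * X i' j' (e (+) a (+) b))%g.
Proof.
move=> nij ow si sj; have [nij' E] := elem_orth e nij ow si sj; split=> //.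
have := lift_rel (u := [:: elem i j e; w]) (v := [:: w; elem i' j' (e (+) a (+) b)]).
by rewrite /= !mulg1 (letter_orth ow) !letter_elem //; apply.
Qed.

Lemma X_comm i j e i' j' f : i != j -> i' != j' -> j != i' -> j' != i ->
  (X i j e * X i' j' f = X i' j' f * X i j e)%g.
Proof.
move=> nij nij' nji' nj'i.
have := lift_rel (u := [:: elem i j e; elem i' j' f]) (v := [:: elem i' j' f; elem i j e]).
rewrite /= !mulg1 !letter_elem //; apply=> //; apply: slz_inj => A k l.
rewrite !slz_mulE !mulmxA !mul_elem // [i' == j]eq_sym [i == j']eq_sym.
by rewrite (negPf nji') (negPf nj'i) !mulr0n !addr0 addrAC.
Qed.

(** Steinberg's commutator relation. In this form the extra letter stands at the left end;
    [X_chain'] puts it at the right end. *)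
Lemma X_chain i j l e f : i != j -> j != l -> i != l ->
  (X i j e * X j l f = X i l (e (+) f) * X j l f * X i j e)%g.
Proof.
move=> nij njl nil.
have := lift_rel (u := [:: elem i j e; elem j l f])
  (v := [:: elem i l (e (+) f); elem j l f; elem i j e]).
rewrite /= !mulg1 !letter_elem // !mulgA; apply=> //; apply: slz_inj => A k m.
rewrite !slz_mulE !mulmxA !mul_elem // eqxx ?[_ == i]eq_sym ?(negPf njl) ?(negPf nij) ?(negPf nil).
by case: (m == l); case: (m == j); case: e; case: f => /=; ring.
Qed.

Lemma X_chain' i j l e f : i != j -> j != l -> i != l ->
  (X j l f * X i j e = X i j e * X j l f * X i l (~~ (e (+) f)))%g.
Proof.
move=> nij njl nil.
have := lift_rel (u := [:: elem j l f; elem i j e])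
  (v := [:: elem i j e; elem j l f; elem i l (~~ (e (+) f))]).
rewrite /= !mulg1 !letter_elem // !mulgA; apply=> //; apply: slz_inj => A k m.
rewrite !slz_mulE !mulmxA !mul_elem // eqxx (negPf nil) (negPf nij).
by case: (m == l); case: (m == j); case: e; case: f => /=; ring.
Qed.

Lemma X_qturn i j e : i != j ->
  lift (qturn i j e) = (X i j e * X j i (~~ e) * X i j e)%g.
Proof.
move=> nij; have nji : j != i by rewrite eq_sym.
have := lift_rel (u := [:: qturn i j e]) (v := [:: elem i j e; elem j i (~~ e); elem i j e]).
rewrite /= !mulg1 !letter_elem // letter_orth ?qturn_orth // !mulgA; apply=> //.

Qed.

Definition ent g r l : int := slz_val (pi g) r l.

Lemma entX g i j e r l : i != j ->
  ent (g * X i j e)%g r l = ent g r l + sgb e * ent g r i *+ (l == j).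
Proof. by move=> nij; rewrite /ent piM pi_lift ?letter_elem // slz_mulE mul_elem. Qed.

Lemma entW g w p l c r : orth (slz_val w) -> signed_row w p l c ->
  ent (g * lift w)%g r l = sgb c * ent g r p.
Proof. by move=> ow s; rewrite /ent piM pi_lift ?letter_orth // slz_mulE (mul_orth _ _ ow s). Qed.

Definition wlift m x := exists2 w, wfix m w & x = lift w.

Lemma wlift1 m : wlift m 1%g.
Proof.
exists 1%g; first exact: wfix1.
have := short (u := [:: 1%g]); rewrite /= !mulg1 letter_orth ?orth1 // => -> //.
Qed.

Lemma wliftM m x y : wlift m x -> wlift m y -> wlift m (x * y)%g.
Proof.
move=> [w wm ->] [w' wm' ->]; exists (w * w')%g; first exact: wfixM.
by rewrite lift_orthM ?(wfix_orth wm) ?(wfix_orth wm').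
Qed.

Lemma wliftV m x : wlift m x -> wlift m x^-1%g.
Proof.
move=> [w wm ->]; exists w^-1%g; first exact: wfixV.
by rewrite liftV // letter_orth // (wfix_orth wm).
Qed.

Lemma wliftW m m' x : (m <= m')%N -> wlift m' x -> wlift m x.
Proof. by move=> le [w wm ->]; exists w => //; apply: wfixW wm. Qed.

(* [a] bounds the sources and [b] the targets of the elementary letters. *)
Definition block (c a b : nat) x := wlift c x \/
  exists i j e, [/\ (a <= i)%N, (b <= j)%N, i != j & x = X i j e].

Lemma blockV c a b x : block c a b x -> block c a b x^-1%g.
Proof.
case=> [wx|[i [j [e [ai bj nij ->]]]]]; first by left; apply: wliftV.
by right; exists i, j, (~~ e); rewrite XV.
Qed.

(** Each letter of this block acts on the coordinates from [m] on only, so the subgroup is the same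
    problem in dimension [n - m]. *)
Lemma block_ent m g r l : gen (block m m m) g -> (r < m)%N || (l < m)%N ->
  ent g r l = (r == l)%:R.
Proof.
move=> Lg; elim: Lg l => [l _|h x _ IH Lx l]; first by rewrite /ent pi1 /= mxE.
case: Lx => [[w wm ->]|[i [j [e [mi mj nij ->]]]]] rlm.
  have [p [c s]] := orth_row_onto l (wfix_orth wm).
  rewrite (entW _ _ (wfix_orth wm) s); have le := wfix_le wm s.
  have [lt_lm|le_ml] := ltnP l m.
    have [ep ec] : p = l /\ c = false.
      have pm : (p < m)%N by rewrite ltnNge -le -ltnNge.
      by have [-> ->] := signed_row_inj s (wfix_row wm pm).
    by rewrite ep ec IH ?lt_lm ?orbT // mul1r.
  move: rlm; rewrite orbC ltnNge le_ml /= => lt_rm; rewrite IH ?lt_rm //.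
  have /negPf -> : r != p by apply: contraTneq lt_rm => ->; rewrite -leqNgt -le.
  have /negPf -> : r != l by apply: contraTneq lt_rm => ->; rewrite -leqNgt.
  by rewrite mulr0.
rewrite entX // IH //; have [lj|_] := eqVneq l j; last by rewrite mulr0n addr0.
have lt_rm : (r < m)%N by move: rlm; rewrite lj [(j < m)%N]ltnNge mj orbF.
rewrite IH ?lt_rm //; have /negPf -> : r != i; last by rewrite mulr0 mul0rn addr0.
by apply: contraTneq lt_rm => ->; rewrite -leqNgt.
Qed.

(** * The orbit of a basis row and the lift of its stabilizer *)

Section Level.
Variable k : 'I_n.
Hypothesis ltkn : (k.+1 < n)%N.

Let G := gen (block k k k).
(** The letters of [G] that fix the basis row [k]: a signed permutation must fix one more row, and
    an elementary letter must have a source other than [k]. *)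
Let S := gen (block k.+1 k.+1 k).
Let rw g l := ent g k l.

Lemma S_G g : S g -> G g.
Proof.
apply: gen_sub => x [wx|[i [j [e [ki kj nij ->]]]]].
  by left; apply: wliftW wx.
by right; exists i, j, e; rewrite (ltnW ki).
Qed.

Lemma S_row s l : S s -> rw s l = (l == k)%:R.
Proof.
move=> Ss; elim: Ss l => [l|h x _ IH Lx l]; first by rewrite /rw /ent pi1 /= mxE eq_sym.
case: Lx => [[w wm ->]|[i [j [e [ki kj nij ->]]]]].
  have [p [c s']] := orth_row_onto l (wfix_orth wm).
  rewrite /rw (entW _ _ (wfix_orth wm) s') -/(rw h p) IH.
  have sk := wfix_row wm (ltnSn k).
  have [ep|npk] := eqVneq p k.
    by rewrite ep in s'; have [<- <-] := signed_row_inj sk s'; rewrite eqxx.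
  have [el|_] := eqVneq l k; last by rewrite mulr0.
  rewrite el in s'; have := orth_col (wfix_orth wm) sk npk.
  by rewrite (signed_rowE _ s') eqxx; case: c {s'}.
rewrite /rw entX // -!/(rw h _) !IH; have /negPf -> : i != k.
  by apply: contraTneq ki => ->; rewrite ltnn.
by rewrite mulr0 mul0rn addr0.
Qed.

Lemma rw_mul s g l : S s -> rw (s * g)%g l = rw g l.
Proof.
by move=> Ss; rewrite /rw /ent piM; apply: mul_row_unit => m; rewrite eq_sym; apply: S_row.
Qed.

Lemma rwX g i j e l : i != j ->
  rw (g * X i j e)%g l = rw g l + sgb e * rw g i *+ (l == j).
Proof. exact: entX. Qed.

(** The l1-norm of the row changes by exactly the size of entry [i]. A letter that carries entry [j]
    past 0 is neither [up] nor [down]. *)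
Definition up g i j e :=
  rw g i != 0 /\ absz (rw g j + sgb e * rw g i) = (absz (rw g j) + absz (rw g i))%N.

Definition down g i j e :=
  rw g i != 0 /\ (absz (rw g j + sgb e * rw g i)%R + absz (rw g i))%N = absz (rw g j).

(* The paths from a basis vector to the row of [g] along which the l1-norm increases. *)
Inductive reach : P -> Prop :=
| reach_base s x : S s -> wlift k x -> reach (s * x)%g
| reach_up g i j e : reach g -> (k <= i)%N -> (k <= j)%N -> i != j -> up g i j e ->
    reach (g * X i j e)%g.

Lemma reach_G g : reach g -> G g.
Proof.
elim=> [s x /S_G Gs wx|h i j e _ Gh ki kj nij _].
  by apply: genMr => //; left.
by apply: genMr => //; right; exists i, j, e.
Qed.

Lemma reach_Sl s g : S s -> reach g -> reach (s * g)%g.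
Proof.
move=> Ss; elim=> [s' x Ss' wx|h i j e _ IH ki kj nij uh].
  by rewrite mulgA; apply: reach_base => //; apply: genM.
by rewrite mulgA; apply: reach_up => //; rewrite /up !rw_mul.
Qed.

Lemma reach_eq g h : reach g -> S (h * g^-1)%g -> reach h.
Proof. by move=> Rg /reach_Sl/(_ Rg); rewrite mulgVK. Qed.

Lemma reach_W g x : reach g -> wlift k x -> reach (g * x)%g.
Proof.
move=> Rg; elim: Rg x => [s x Ss wx y wy|h i j e _ IH ki kj nij [hi hj] x wx].
  by rewrite -mulgA; apply: reach_base => //; apply: wliftM.
have [w wk ew] := wx; have ow := wfix_orth wk.
have [i' [a si]] := orth_row i ow; have [j' [b sj]] := orth_row j ow.
have [nij' E] := X_orth e nij ow si sj.
rewrite ew -mulgA E mulgA -ew; apply: reach_up; rewrite ?(wfix_le wk si) ?(wfix_le wk sj) //.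
  exact: IH.
rewrite /up ew /rw (entW _ _ ow si) (entW _ _ ow sj) -!/(rw h _).
by case: (a) (b) (e) hi hj => -[] [] /=; lia.
Qed.

(** The letter does not change the row of [g], so its conjugate should lie in the lift of the
    stabilizer. Along the path, a last increasing letter [X a b d] makes entry [b] nonzero, whence
    [b != i]; the Steinberg relations then move it away, leaving conjugates of letters with the same
    source [i] by the shorter path. *)
Lemma reach_stab g i j e : reach g -> (k <= i)%N -> (k <= j)%N -> i != j ->
  rw g i = 0 -> S (g * X i j e * g^-1)%g.
Proof.
move=> Rg; elim: Rg i j e => [s x Ss [w wk ->]|h a b d _ IH ka kb nab [ha hb]] i j e ki kj nij gi.
  have ow := wfix_orth wk.
  have [p [c sp]] := orth_row_onto i ow; have [q [f sq]] := orth_row_onto j ow.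
  have npq : p != q.
    by apply: contraNneq nij => epq; rewrite epq in sp; have [->] := signed_row_inj sp sq.
  have [_] := X_orth (e (+) c (+) f) npq ow sp sq.
  have -> : e (+) c (+) f (+) c (+) f = e by case: (e) (c) (f) => -[] [].
  move=> E; have npk : p != k.
    move: gi; rewrite /rw (entW _ _ ow sp) -/(rw s p) S_row //.
    by case: eqP => //; case: (c).
  rewrite -(mulgA s) -E invgM !mulgA mulgK.
  apply: genM; last by apply: genV => // ? /blockV.
  apply: genM => //; apply: gen_in; right; exists p, q, (e (+) c (+) f); split=> //.
    by rewrite ltn_neqAle -(wfix_le wk sp) ki andbT eq_sym.
  by rewrite -(wfix_le wk sq).
have nib : i != b.
  by apply: contraTneq ha => eib; move: gi; rewrite eib /rw entX // -!/(rw h _) eqxx; lia.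
have hi : rw h i = 0 by move: gi; rewrite /rw entX // (negPf nib) mulr0n addr0.
have {}IH j' e' : (k <= j')%N -> i != j' -> S (h * X i j' e' * h^-1)%g.
  by move=> kj' nij'; apply: IH.
have [eja|nja] := eqVneq j a; last first.
  have nbi : b != i by rewrite eq_sym.
  rewrite -(mulgA h) (X_comm _ _ nab nij nbi nja) invgM !mulgA mulgK.
  exact: IH.
rewrite eja in nij kj *; rewrite -(mulgA h) (X_chain' _ _ nij nab nib).
rewrite invgM !mulgA.
have -> : (h * X i a e * X a b d * X i b (~~ (e (+) d)) / X a b d / h =
   (h * X i a e / h) * (h * X i b (~~ (e (+) d)) / h))%g.
  have nba : b != a by rewrite eq_sym.
  have nbi : b != i by rewrite eq_sym.
  by rewrite -(mulgA (h * X i a e)%g) (X_comm _ _ nab nib nbi nba) !mulgA mulgK mulgVK.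
by apply: genM; apply: IH.
Qed.

Lemma reach_stabW g i j e : reach g -> (k <= i)%N -> (k <= j)%N -> i != j ->
  rw g i = 0 -> reach (g * X i j e)%g.
Proof. by move=> Rg ki kj nij gi; apply: (reach_eq Rg); apply: reach_stab. Qed.

Definition row_norm g := (\sum_l absz (rw g l))%N.

Lemma row_normX g i j e : i != j -> 
  (row_norm (g * X i j e)%g + absz (rw g j) = row_norm g + absz (rw g j + sgb e * rw g i)%R)%N.
Proof.
move=> nij; rewrite /row_norm (bigD1 j) //= [in RHS](bigD1 j) //=.
rewrite {1}/rw entX // eqxx mulr1n -!/(rw g _).
under [X in (_ + X + _)%N]eq_bigr => l nlj.
  rewrite /rw entX // (negPf nlj) mulr0n addr0 -/(rw g l); over.
by rewrite addnAC addnC addnA addnAC (addnC (absz _)) addnAC.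
Qed.

Lemma eq_row_norm g h : (forall l, rw g l = rw h l) -> row_norm g = row_norm h.
Proof. by move=> E; rewrite /row_norm; apply: eq_bigr => l _; rewrite E. Qed.

(** Euclid's algorithm read backwards: the inverse of each descending step is an increasing one.
    Only the row of [g] is attained at this stage, not [g] itself. *)
Lemma reach_exists g : G g -> exists2 h, reach h & forall l, rw h l = rw g l.
Proof.
have [N] := ubnP (row_norm g); elim: N g => // N IH g ltN Gg.
have lowg i l : (i < k)%N -> slz_val (pi g) i l = (i == l)%:R.
  by move=> ik; apply: (block_ent Gg); rewrite ik.
have [[i [e [ki s]]]|[i [j [e [ki nij gi dij]]]]] := euclid_row lowg.
  have [w wk sw] := wfix_trans e ltkn ki.
  exists (1 * lift w)%g; first by apply: reach_base; [apply: gen1 | exists w].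
  move=> l; rewrite /rw /ent (signed_rowE _ s) mul1g pi_lift ?(signed_rowE _ sw) //.
  exact: letter_orth (wfix_orth wk).
have {}gi : rw g i != 0 by [].
have {}dij : (absz (rw g j + sgb e * rw g i)%R + absz (rw g i))%N = absz (rw g j) by [].
have kj : (k <= j)%N.
  rewrite leqNgt; apply/negP => jk; move: dij gi.
  have /negPf nkj : k != j by rewrite -val_eqE /= neq_ltn jk orbT.
  have -> : rw g j = 0 by rewrite /rw (block_ent Gg) ?jk ?orbT // nkj.
  by lia.
have [||h Rh Eh] := IH (g * X i j e)%g.
- by have := row_normX g e nij; lia.
- by apply: genMr => //; right; exists i, j, e.
have Eg l : rw (h * X i j (~~ e))%g l = rw g l.
  rewrite rwX // !Eh !rwX // (negPf nij).
  by case: (l == j); case: (e) => /=; lia.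
exists (h * X i j (~~ e))%g => //; apply: reach_up => //.
rewrite /up !Eh !rwX // eqxx (negPf nij).
by move: gi dij; case: (e) => /=; lia.
Qed.

(** The bound [N] carries the induction: rerouting around a row of norm [N] appeals to uniqueness
    strictly below it only. *)
Definition coset_uniq N := forall g h, reach g -> reach h ->
  (forall l, rw g l = rw h l) -> (row_norm g < N)%N -> S (g * h^-1)%g.

(** Some reached [h] has the row of the lower end. Going back up from [h] gives a reached element
    with the row of [g]; uniqueness puts it in the coset of [g], hence [h] in the coset of the lower
    end. *)
Lemma reach_down N g i j e : coset_uniq N -> reach g -> (row_norm g < N)%N ->
  (k <= i)%N -> (k <= j)%N -> i != j -> down g i j e -> reach (g * X i j e)%g.
Proof.
move=> UN Rg ltN ki kj nij [gi dij].
have [|h Rh Eh] := @reach_exists (g * X i j e)%g.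
  by apply: genMr; [apply: reach_G | right; exists i, j, e].
have Rh' : reach (h * X i j (~~ e))%g.
  apply: reach_up => //; rewrite /up !Eh !rwX // eqxx (negPf nij).
  by move: gi dij; case: (e) => /=; lia.
apply: (reach_eq Rh).
have -> : (g * X i j e / h = g * (h * X i j (~~ e))^-1)%g.
  by rewrite invgM -XV // negbK mulgA.
apply: UN => // l; rewrite rwX // !Eh !rwX // (negPf nij).
by case: (l == j); case: (e) => /=; lia.
Qed.

Lemma reach_step N g i j e : coset_uniq N -> reach g -> (row_norm g < N)%N ->
  (k <= i)%N -> (k <= j)%N -> i != j ->
  absz (rw g j + sgb e * rw g i) = (absz (rw g j) + absz (rw g i))%N \/
  (absz (rw g j + sgb e * rw g i)%R + absz (rw g i))%N = absz (rw g j) ->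
  reach (g * X i j e)%g.
Proof.
move=> UN Rg ltN ki kj nij; have [gi|gi] := eqVneq (rw g i) 0.
  by move=> _; apply: reach_stabW.
by case=> E; [apply: reach_up | apply: (reach_down UN)].
Qed.

Lemma row_norm_down h i j e : i != j -> down h i j e -> (row_norm (h * X i j e)%g < row_norm h)%N.
Proof. by move=> nij [hi dij]; have := row_normX h e nij; lia. Qed.

(** * Peak reduction: passing from one descent to another below a local maximum *)

Section Peak.
Variables (N : nat) (g : P).
Hypotheses (UN : coset_uniq N) (leN : (row_norm g <= N)%N).

(** The letters commute and change different entries, so the peak is replaced by the opposite corner
    of a square, lower than both of its neighbours. *)
Lemma peak_comm i j e i' j' f : (k <= i)%N -> (k <= j)%N -> (k <= i')%N -> (k <= j')%N ->
  i != j -> i' != j' -> j != i' -> j' != i -> j != j' ->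
  reach (g * X i j e)%g -> down g i j e -> down g i' j' f -> reach (g * X i' j' f)%g.
Proof.
move=> ki kj ki' kj' nij nij' nji' nj'i njj' R1 [gi dij] [gi' dij'].
have lt1 := row_norm_down nij (conj gi dij).
have -> : (g * X i' j' f = g * X i j e * X i' j' f * X i j (~~ e))%g.
  by rewrite -(mulgA g) X_comm // XV // !mulgA mulgK.
have d' : down (g * X i j e)%g i' j' f.
  by rewrite /down !rwX // [i' == j]eq_sym [j' == j]eq_sym (negPf nji') (negPf njj') !mulr0n !addr0.
have lt2 := row_norm_down nij' d'.
apply: (reach_step UN) => //; [apply: (reach_down UN) => // | | ]; try lia.
rewrite !rwX // eqxx (negPf nij) (negPf njj') [i == j']eq_sym (negPf nj'i).
by left; move: dij; case: (e) => /=; lia.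
Qed.

Lemma peak_chain i j l e f : (k <= i)%N -> (k <= j)%N -> (k <= l)%N ->
  i != j -> j != l -> i != l ->
  reach (g * X i j e)%g -> down g i j e -> down g j l f -> reach (g * X j l f)%g.
Proof.
move=> ki kj kl nij njl nil R1 [gi dij] [gj djl].
have lt1 := row_norm_down nij (conj gi dij).
(* Write [v] for the row of [g]. After entry [j] has lost [|v_i|], entry [l] loses [|v_i|] and the
   remaining [|v_j| - |v_i|]; the last letter restores entry [j]. All intermediate rows are below
   the peak. *)
have -> : (g * X j l f = g * X i j e * X i l (~~ e (+) f) * X j l f * X i j (~~ e))%g.
  rewrite -!(mulgA (g * X i j e)%g) -X_chain // XV // !mulgA mulgK //.
set h := (g * X i j e)%g in R1 lt1 *.
have hi : rw h i = rw g i by rewrite rwX // (negPf nij) mulr0n addr0.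
have hl : rw h l = rw g l by rewrite rwX // [l == j]eq_sym (negPf njl) mulr0n addr0.
have hj : rw h j = rw g j + sgb e * rw g i by rewrite rwX // eqxx mulr1n.
have d1 : down h i l (~~ e (+) f).
  by rewrite /down hi hl; move: gi gj dij djl; case: (e); case: (f) => /=; lia.
have lt2 := row_norm_down nil d1; have R2 := reach_down UN R1 _ ki kl nil d1.
set h2 := (h * X i l _)%g in lt2 R2 *.
have h2i : rw h2 i = rw g i by rewrite rwX // (negPf nil) mulr0n addr0.
have h2j : rw h2 j = rw g j + sgb e * rw g i by rewrite rwX // (negPf njl) mulr0n addr0.
have h2l : rw h2 l = rw g l + sgb (~~ e (+) f) * rw g i by rewrite rwX // eqxx mulr1n hl hi.
have E : (absz (rw h2 l + sgb f * rw h2 j)%R + absz (rw h2 j))%N = absz (rw h2 l).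
  by rewrite h2j h2l; move: gi gj dij djl; case: (e); case: (f) => /=; lia.
have R3 : reach (h2 * X j l f)%g by apply: (reach_step UN) => //; [apply: R2; lia | lia | right].
apply: (reach_step UN) => //; first by have := row_normX h2 f njl; lia.
rewrite ![rw (h2 * _)%g _]rwX // (negPf njl) (negPf nil) !mulr0n !addr0 h2i h2j.
by left; move: gi gj dij djl; case: (e); case: (f) => /=; lia.
Qed.

Lemma peak_chain' i j l e f : (k <= i)%N -> (k <= j)%N -> (k <= l)%N ->
  l != i -> i != j -> l != j ->
  reach (g * X i j e)%g -> down g i j e -> down g l i f -> reach (g * X l i f)%g.
Proof.
move=> ki kj kl nli nij nlj R1 [gi dij] [gl dli].
have lt1 := row_norm_down nij (conj gi dij).
have -> : (g * X l i f = g * X i j e * X l i f * X i j (~~ e) * X l j (~~ (f (+) ~~ e)))%g.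
  by rewrite -!(mulgA (g * X i j e)%g) -X_chain' // XV // !mulgA mulgK.
set h := (g * X i j e)%g in R1 lt1 *.
have hi : rw h i = rw g i by rewrite rwX // (negPf nij) mulr0n addr0.
have hl : rw h l = rw g l by rewrite rwX // (negPf nlj) mulr0n addr0.
have hj : rw h j = rw g j + sgb e * rw g i by rewrite rwX // eqxx mulr1n.
have d1 : down h l i f by rewrite /down hi hl.
have lt2 := row_norm_down nli d1; have R2 := reach_down UN R1 _ kl ki nli d1.
set h2 := (h * X l i _)%g in lt2 R2 *.
have h2l : rw h2 l = rw g l by rewrite rwX // (negPf nli) mulr0n addr0.
have h2j : rw h2 j = rw g j + sgb e * rw g i.
  by rewrite rwX // [j == i]eq_sym (negPf nij) mulr0n addr0.
have h2i : rw h2 i = rw g i + sgb f * rw g l by rewrite rwX // eqxx mulr1n hl hi.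
have E : absz (rw h2 j + sgb (~~ e) * rw h2 i) = (absz (rw h2 j) + absz (rw h2 i))%N.
  by rewrite h2j h2i; move: gi gl dij dli; case: (e); case: (f) => /=; lia.
have R3 : reach (h2 * X i j (~~ e))%g.
  by apply: (reach_step UN) => //; [apply: R2; lia | lia | left].
have E3 := row_normX h2 (~~ e) nij.
(* The third letter ascends, but only by [|v_i| - |v_l|] after descents by [|v_i|] and [|v_l|], with
   [v] the row of [g]: the path stays [2 |v_l|] below the peak. *)
apply: (reach_step UN) => //.
  have := row_normX g e nij; rewrite -/h -hj => E1.
  have := row_normX h f nli; rewrite -/h2 hi hl -h2i => E2.
  have a1 : (absz (rw h j) + absz (rw g i))%N = absz (rw g j) by rewrite hj.
  have a2 : (absz (rw h2 i) + absz (rw g l))%N = absz (rw g i) by rewrite h2i.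
  have : (0 < absz (rw g l))%N by rewrite absz_gt0.
  by lia.
rewrite ![rw (h2 * _)%g _]rwX // eqxx (negPf nlj) !mulr0n !mulr1n !addr0 h2i h2j h2l.
by left; move: gi gl dij dli; case: (e); case: (f) => /=; lia.
Qed.

Lemma peak i j e i' j' f : (k <= i)%N -> (k <= j)%N -> (k <= i')%N -> (k <= j')%N ->
  i != j -> i' != j' ->
  reach (g * X i j e)%g -> down g i j e -> down g i' j' f -> reach (g * X i' j' f)%g.
Proof.
move=> ki kj ki' kj' nij nij' R1 d d'.
have [eji'|nji'] := eqVneq j i'; have [ej'i|nj'i] := eqVneq j' i.
- have [gi dij] := d; have [gi' dij'] := d'; rewrite -{}eji' {}ej'i in gi' dij' kj' ki' nij' d' *.
  have ef : e = f by move: gi gi' dij dij'; case: (e); case: (f) => /=; lia.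
  have g1j : rw g j + sgb e * rw g i = 0.
    by move: gi gi' dij dij'; rewrite -ef; case: (e) => /=; lia.
  (* Opposite letters can both descend only if the two entries have equal size. The first descent
     then makes entry [j] zero, the quarter turn moves this zero to entry [i], and the last letter
     has a zero source. *)
  have -> : (g * X j i f = g * X i j e * lift (qturn i j (~~ e)) * X i j e)%g.
    by rewrite X_qturn // XV // negbK ef !mulgA mulgK mulgVK.
  apply: reach_stabW => //.
    by apply: reach_W => //; exists (qturn i j (~~ e)) => //; apply: wfix_qturn.
  rewrite /rw /ent piM pi_lift ?letter_orth ?qturn_orth // slz_mulE mul_qturn //.
  by rewrite (negPf nij) eqxx -/(ent _ k j) -/(rw _ j) rwX // eqxx g1j mulr0.
- rewrite -eji' in nij' d' *; rewrite eq_sym in nj'i.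
  exact: (peak_chain ki kj kj' nij nij' nj'i R1 d d').
- rewrite ej'i in nij' d' *; rewrite eq_sym in nji'.
  exact: (peak_chain' ki kj ki' nij' nij nji' R1 d d').
have [ejj'|njj'] := eqVneq j j'; last first.
  exact: (peak_comm ki kj ki' kj' nij nij' nji' nj'i njj' R1 d d').
rewrite -ejj' in kj' nij' nj'i d' *.
have [eii'|nii'] := eqVneq i i'.
  rewrite -eii' in d' *; have [gi dij] := d; have [gi' dij'] := d'.
  by have <- : e = f by move: gi gi' dij dij'; case: (e); case: (f) => /=; lia.
have [gi dij] := d; have [gi' dij'] := d'.
(* Two different sources for the same column: performing both steps might carry entry [j] past 0. A
   third descent, of the larger source by the smaller, forms with each of the two a pair already
   treated. *)
have [le|/ltnW le] := leqP (absz (rw g i')) (absz (rw g i)).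
  have [c dc] : exists c, down g i' i c.
    case: (leP 0 (rw g i * rw g i')) => s.
      by exists true; split => //=; nia.
    by exists false; split => //=; nia.
  have ni'i : i' != i by rewrite eq_sym.
  have Rc := peak_chain' ki kj ki' ni'i nij nij' R1 d dc.
  exact: (peak_comm ki' ki ki' kj ni'i nij' nii' nji' nij Rc dc d').
have [c dc] : exists c, down g i i' c.
  case: (leP 0 (rw g i * rw g i')) => s.
    by exists true; split => //=; nia.
  by exists false; split => //=; nia.
have ni'i : i' != i by rewrite eq_sym.
have nji : j != i by rewrite eq_sym.
have nj'j : j != i' by [].
have Rc := peak_comm ki kj ki ki' nij nii' nji ni'i nj'j R1 d dc.
exact: (peak_chain ki ki' kj nii' nij' nij Rc dc d').
Qed.

End Peak.

Lemma row_norm_base s x : S s -> wlift k x -> row_norm (s * x)%g = 1%N.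
Proof.
move=> Ss [w wk ->]; have ow := wfix_orth wk.
have [p [c sp]] := orth_row k ow.
rewrite /row_norm (bigD1 p) //= big1 => [|l nlp].
  by rewrite {1}/rw (entW _ _ ow sp) -/(rw s k) S_row // eqxx; case: (c).
rewrite rw_mul // /rw /ent pi_lift ?letter_orth //.
by rewrite (signed_rowE _ sp) (negPf nlp).
Qed.

Lemma row_norm_gt0 g i : rw g i != 0 -> (0 < row_norm g)%N.
Proof. by move=> gi; rewrite /row_norm (bigD1 i) //= addn_gt0 absz_gt0 gi. Qed.

Lemma row_norm_up g i j e : i != j -> up g i j e -> (1 < row_norm (g * X i j e)%g)%N.
Proof.
by move=> nij [gi uij]; have := row_normX g e nij; have := row_norm_gt0 gi; lia.
Qed.

(** Norm 1 occurs only at the bases of paths, since an increasing letter ends above 1. Otherwise the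
    last letters of both paths, inverted, descend from the common row; [peak] lets [g] descend along
    the last letter of [h], and uniqueness applies at the smaller row. *)
Lemma reach_coset_uniq N : coset_uniq N.
Proof.
elim: N => // N UN g h Rg Rh; rewrite ltnS.
case: Rg => [s x Ss wx|g1 i j e R1 ki kj nij u1] E leN.
  case: Rh E => [s' x' Ss' wx'|h1 i' j' f R1' ki' kj' nij' u1'] E; last first.
    by have := row_norm_up nij' u1'; rewrite -(eq_row_norm E) row_norm_base.
  have {}E l : rw x l = rw x' l by have := E l; rewrite !rw_mul.
  have [[w wk ex] [w' wk' ex']] := (wx, wx').
  have Sx : S (x * x'^-1)%g.
    apply: gen_in; left; exists (w * w'^-1)%g; last first.
      rewrite lift_orthM ?liftV ?letter_orth ?orthV ?(wfix_orth wk) ?(wfix_orth wk') //.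
      by rewrite ex ex'.
    have wM := wfixM wk (wfixV wk'); apply: wfixP => [|i]; first exact: wfix_orth wM.
    rewrite ltnS leq_eqVlt => /orP[/eqP/val_inj ->|lt_ik] l; last by rewrite (wfixE _ wM).
    apply: row_divg => m; have := E m.
    by rewrite /rw /ent ex ex' !pi_lift ?letter_orth ?(wfix_orth wk) ?(wfix_orth wk').
  rewrite invgM !mulgA -(mulgA s); apply: genM; last by apply: genV => // ? /blockV.
  exact: genM.
case: Rh E => [s' x' Ss' wx'|h1 i' j' f R1' ki' kj' nij' u1'] E.
  by have := row_norm_up nij u1; rewrite (eq_row_norm E) row_norm_base.
set g0 := (g1 * X i j e)%g in E leN *.
have eg1 : (g0 * X i j (~~ e))%g = g1 by rewrite XV // mulgK.
have eh1 : (h1 * X i' j' f * X i' j' (~~ f))%g = h1 by rewrite [X _ _ (~~ _)]XV // mulgK.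
have d : down g0 i j (~~ e).
  move: u1; rewrite /down /up -eg1 !rwX // eqxx (negPf nij) mulr0n !addr0.
  by case: (e) => /=; lia.
have d' : down g0 i' j' (~~ f).
  move: u1'; rewrite /down /up !E -eh1 !rwX // eqxx (negPf nij') !mulr0n !addr0.
  by case: (f) => /=; lia.
have R2 : reach (g0 * X i' j' (~~ f))%g by apply: (peak UN leN) d d'; rewrite ?eg1.
have -> : (g0 / (h1 * X i' j' f) = g0 * X i' j' (~~ f) / h1)%g.
  by rewrite invgM -XV // mulgA.
apply: UN => // [l|]; last by apply: leq_trans (row_norm_down nij' d') leN.
by rewrite -[in RHS]eh1 [LHS]rwX // [RHS]rwX // !E.
Qed.

Lemma reachX g i j e : reach g -> (k <= i)%N -> (k <= j)%N -> i != j ->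
  reach (g * X i j e)%g.
Proof.
move=> Rg ki kj nij; have nji : j != i by rewrite eq_sym.
have UN := @reach_coset_uniq.
(* A step overshooting 0 factors through the descent in the other direction. *)
pose over := [&& rw g j != 0, (absz (rw g j) < absz (rw g i))%N &
  absz (rw g j + sgb e * rw g i) != (absz (rw g j) + absz (rw g i))%N].
have [/and3P[gj lt nu]|no] := boolP over; last first.
  apply: (reach_step (UN (row_norm g).+1)) => //; move: no; rewrite /over.
  by case: (e) => /=; lia.
have -> : (g * X i j e = g * X j i e * X i j (~~ e) * lift (qturn i j e))%g.
  by rewrite X_qturn // (XV e nij) (XV e nji) !mulgA mulgVK mulgK.
apply: reach_W; last by exists (qturn i j e) => //; apply: wfix_qturn.
apply: (reach_step (UN (row_norm (g * X j i e)%g).+1)) => //.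
  apply: (reach_step (UN (row_norm g).+1)) => //.
  by move: gj lt nu; case: (e) => /=; lia.
rewrite !rwX // eqxx (negPf nji) !mulr0n !mulr1n !addr0.
by move: gj lt nu; case: (e) => /=; lia.
Qed.

Lemma G_reach g : G g -> reach g.
Proof.
elim=> [|h x _ Rh].
  by rewrite -[1%g]mulg1; apply: reach_base; [apply: gen1 | apply: wlift1].
by case=> [|[i [j [e [ki kj nij ->]]]]]; [apply: reach_W | apply: reachX].
Qed.

(** The neutral element is reached and has the same row, so uniqueness compares [g] with it. Thus
    [S] is the full stabilizer of the basis row in [G]. *)
Lemma stab_row g : G g -> (forall l, rw g l = (l == k)%:R) -> S g.
Proof.
move=> /G_reach Rg E; have R1 : reach 1%g by apply: G_reach; apply: gen1.
rewrite -[g]mulg1 -invg1; apply: (@reach_coset_uniq (row_norm g).+1) => // l.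
by rewrite E /rw /ent pi1 /= mxE eq_sym.
Qed.

End Level.
Lemma lift1 : lift 1%g = 1%g.
Proof.
have := short (u := [:: 1%g]); rewrite /= !mulg1 letter_orth ?orth1 //; by apply.
Qed.

(** * The stabilizer as translations extended by the next block *)

Section Translations.
Variable k : 'I_n.

(* The letters adding multiples of the columns [i >= m], [i > k] to column [k]. *)
Let trans m x := exists i e, [/\ (m <= i)%N, (k < i)%N & x = X i k e].
Let T m := gen (trans m).
Let H := gen (block k.+1 k.+1 k.+1).

Lemma neq_k i : (k < i)%N -> i != k.
Proof. by apply: contraTneq => ->; rewrite ltnn. Qed.

Lemma trans_ent m t r l : T m t -> (l != k) || (r < m)%N || (r == k) ->
  ent t r l = (r == l)%:R.
Proof.
move=> Tt; elim: Tt l => [l _|h x _ IH [i [e [mi ki ->]]] l rl].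
  by rewrite /ent pi1 /= mxE.
have nik := neq_k ki; rewrite entX // IH //.
have [elk|_] := eqVneq l k; last by rewrite mulr0n addr0.
rewrite IH ?nik // [r == i](_ : _ = false) ?mulr0 ?addr0 //.
apply/negP => /eqP eri; move: rl; rewrite elk eqxx eri (negPf nik) orbF /=.
by rewrite ltnNge mi.
Qed.

(** Translation letters commute, so the powers of one of them are collected at the end; the sign [e]
    and the size [a] encode an integer exponent. *)
Lemma trans_peel m (im : 'I_n) t : m = im :> nat -> (k < m)%N -> T m t ->
  exists t' e a, T m.+1 t' /\ t = (t' * X im k e ^+ a)%g.
Proof.
move=> em km; have kim : (k < im)%N by rewrite -em.
elim=> [|h x _ [t' [e [a [Tt' ->]]]] [i [f [mi ki ->]]]].
  by exists 1%g, true, 0%N; split; [apply: gen1 | rewrite mulg1].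
have nik := neq_k ki; have nmk := neq_k kim.
have [eim|nim] := eqVneq i im; last first.
  exists (t' * X i k f)%g, e, a; split.
    apply: genMr => //; exists i, f; split => //.
    by rewrite ltn_neqAle mi andbT em eq_sym.
  rewrite -!mulgA; congr (_ * _)%g; elim: (a) => [|c IHc]; first by rewrite mulg1 mul1g.
  by rewrite expgS -mulgA IHc !mulgA (X_comm e f nmk nik) 1?[k == _]eq_sym.
rewrite eim; have [->|nfe] := eqVneq f e.
  by exists t', e, a.+1; rewrite expgSr mulgA.
have -> : f = ~~ e by move: nfe; case: (f); case: (e).
case: a => [|a].
  by exists t', (~~ e), 1%N; rewrite expg0 mulg1 expg1.
by exists t', e, a; rewrite expgSr XV // !mulgA mulgK.
Qed.

Lemma trans_power t i e a : (k < i)%N ->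
  ent (t * X i k e ^+ a)%g i k = ent t i k + sgb e * ent t i i *+ a /\
  ent (t * X i k e ^+ a)%g i i = ent t i i.
Proof.
move=> ki; have nik := neq_k ki.
elim: a => [|a [IH1 IH2]]; first by rewrite expg0 mulg1 mulr0n addr0.
by rewrite expgSr mulgA !entX // IH1 IH2 (negPf nik) eqxx mulr0n addr0 mulr1n -addrA -mulrSr.
Qed.

(** Entry (i, k) reads off, up to sign, the exponent of the letter with source [i]; a zero entry
    therefore eliminates that letter, one source at a time. *)
Lemma trans_trivial m t : T m t -> (k < m)%N ->
  (forall i, i != k -> ent t i k = 0) -> t = 1%g.
Proof.
have [d] := ubnP (n - m); elim: d m t => // d IH m t; rewrite ltnS => led Tt km E.
have [le_nm|lt_mn] := leqP n m.
  case: Tt => // h x _ [i [e [mi _ _]]].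
  by move: (leq_trans le_nm mi); rewrite leqNgt ltn_ord.
pose i := Ordinal lt_mn; have [t' [e [a [Tt' et]]]] := trans_peel (im := i) erefl km Tt.
have kmi : (k < i)%N by []. have nik := neq_k kmi.
have := E i nik; rewrite et; have [-> _] := trans_power t' e a kmi.
have -> : ent t' i k = 0 by rewrite (trans_ent Tt') ?ltnSn ?orbT // (negPf nik).
have -> : ent t' i i = 1 by rewrite (trans_ent Tt') ?nik // eqxx.
rewrite add0r mulr1 => /eqP; rewrite mulrn_eq0 orbC; have -> : (sgb e == 0) = false by case: (e).
rewrite orFb.
move=> /eqP a0; rewrite et a0 expg0 mulg1 in E *.
apply: (IH m.+1) => //; first by lia.
exact: ltnW.
Qed.

(** A letter of [H] conjugates a translation letter to a translation letter or, by the Steinberg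
    relation, to a product of two. *)
Lemma trans_conj g t : H g -> T k.+1 t -> T k.+1 (g * t * g^-1)%g.
Proof.
move=> Hg; elim: Hg t => [t|h x _ IH Lx t Tt]; first by rewrite mul1g invg1 mulg1.
rewrite invgM !mulgA -(mulgA h) -(mulgA h); apply: IH.
elim: Tt => [|t' y _ IHt [i [e [_ ki ->]]]]; first by rewrite mulg1 mulgV; apply: gen1.
have -> : (x * (t' * X i k e) / x = (x * t' / x) * (x * X i k e / x))%g.
  by rewrite !mulgA mulgVK.
apply: genM => //; have nik := neq_k ki; case: Lx => [[w wm ->]|[a [b [d [ka kb nab ->]]]]].
  have ow := wfix_orth wm.
  have [p [c sp]] := orth_row_onto i ow; have sk := wfix_row wm (ltnSn k).
  have kp : (k < p)%N by rewrite -(wfix_le wm sp).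
  have [_ E] := X_orth (e (+) c) (neq_k kp) ow sp sk.
  have {}E : (lift w * X i k e = X p k (e (+) c) * lift w)%g.
    by rewrite E addbF addbK.
  by rewrite E mulgK; apply: gen_in; exists p, (e (+) c).
have nak := neq_k ka; have nbk := neq_k kb.
have [ebi|nbi] := eqVneq b i.
  rewrite ebi in nab *; rewrite (X_chain d e nab nik nak) mulgK.
  by apply: genM; apply: gen_in; [exists a, (d (+) e) | exists i, e].
rewrite (X_comm d e nab nik nbi) 1?eq_sym // mulgK.
by apply: gen_in; exists i, e.
Qed.

(** Since [H] normalizes the translations, each translation letter met along the word can be moved
    to the left of the [H] part. *)
Lemma stab_split g : gen (block k.+1 k.+1 k) g -> exists2 t, T k.+1 t & H (t^-1 * g)%g.
Proof.
elim=> [|h x _ [t Tt Hh] Lx]; first by exists 1%g; rewrite ?mulg1 ?invg1; apply: gen1.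
case: Lx => [wx|[i [j [e [ki kj nij ->]]]]].
  by exists t => //; rewrite mulgA; apply: genMr => //; left.
have [ejk|njk] := eqVneq j k; last first.
  exists t => //; rewrite mulgA; apply: genMr => //; right; exists i, j, e; split=> //.
  by rewrite ltn_neqAle kj eq_sym njk.
rewrite ejk; pose u := (t^-1 * h * X i k e * (t^-1 * h)^-1)%g.
have Tu : T k.+1 u by apply: trans_conj => //; apply: gen_in; exists i, e.
exists (t * u)%g; first exact: genM.
suff -> : ((t * u)^-1 * (h * X i k e) = t^-1 * h)%g by [].
apply: (mulgI (t * u)%g); rewrite mulVKg -mulgA /u mulgVK !mulgA mulgV.
by rewrite mul1g.
Qed.

(** The [H] part has trivial column [k], so column [k] of [pi g] is that of the translation part,
    which is therefore trivial. *)
Lemma stab_trivial g : gen (block k.+1 k.+1 k) g -> pi g = 1%g -> H g.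
Proof.
move=> Sg g1; have [t Tt Ht] := stab_split Sg.
suff t1 : t = 1%g by move: Ht; rewrite t1 invg1 mul1g.
apply: (trans_trivial Tt) => // i nik; have : ent (t * (t^-1 * g))%g i k = 0.
  by rewrite mulgA mulgV mul1g /ent g1 /= mxE (negPf nik).
rewrite /ent piM slz_mulE mxE (bigD1 k) //= big1 => [|l nlk].
  by rewrite -/(ent _ k k) (block_ent Ht) ?ltnSn // eqxx mulr1 addr0.
by rewrite -/(ent _ l k) (block_ent Ht) ?ltnSn ?orbT // (negPf nlk) mulr0.
Qed.

End Translations.

(** [stab_row] and [stab_trivial] together lower the block by one coordinate. With one coordinate
    left there is no room for an elementary letter, and only the lift of a signed permutation
    remains, determined by its image. *)
Lemma block_trivial (k : 'I_n) g : gen (block k k k) g -> pi g = 1%g -> g = 1%g.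
Proof.
have [d] := ubnP (n - k); elim: d k g => // d IH k g; rewrite ltnS => led Lg g1.
have [ltkn|] := ltnP k.+1 n.
  pose k' := Ordinal ltkn; apply: (IH k') => //=; first by have := ltn_ord k; lia.
  apply: stab_trivial => //; apply: (stab_row ltkn) => // l.
  by rewrite /ent g1 /= mxE eq_sym.
move=> lenk; have [w wk ew] : wlift k g.
  elim: Lg => [|h x _ wh [wx|[i [j [e [ki kj /eqP nij _]]]]]]; [exact: wlift1 | exact: wliftM |].
  by case: nij; apply: val_inj => /=; have := ltn_ord i; have := ltn_ord j; lia.
move: g1; rewrite ew pi_lift ?letter_orth ?(wfix_orth wk) // => ->; exact: lift1.
Qed.

Theorem words_trivial u : (0 < n)%N -> all letter u -> wprod u = 1%g ->
  wprod (map lift u) = 1%g.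
Proof.
move=> n0 lu u1; apply: (@block_trivial (Ordinal n0)) => /=; last first.
  rewrite -u1; elim: u lu {u1} => [|x u IH] /=; first by rewrite pi1.
  by case/andP=> lx lu; rewrite piM pi_lift // IH.
elim: u lu {u1} => [|x u IH] /=; first by move=> _; apply: gen1.
case/andP=> lx /IH; apply: genM; apply: gen_in.
case/orP: lx => [ox|/existsP[i] /existsP[j] /existsP[e] /andP[nij /eqP ->]].
  by left; exists x => //; apply: wfixP.
by right; exists i, j, e.
Qed.

End Presentation.

(** * The letters generate SL(n,Z) and form a finite list *)

Section Generation.
Variable n : nat.

(** In the last row no second coordinate can absorb a sign; there the determinant rules the sign
    out. *)
Lemma flip_last_det (k : 'I_n) (A : SLZ n) : k.+1 = n ->
  (forall (i l : 'I_n), (i < k)%N -> slz_val A i l = (i == l)%:R) -> ~~ signed_row A k k true.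
Proof.
move=> ekn lowA; apply/negP => s.
have /eqP := slz_det A.
have -> : slz_val A = diag_mx (\row_i (if i == k then -1 else 1)).
  apply/matrixP => i l; rewrite !mxE; have [->|nik] := eqVneq i k.
    by rewrite (signed_rowE _ s) [k == l]eq_sym.
  rewrite lowA; last by have := ltn_ord i; move: nik; rewrite -val_eqE /=; lia.
  by [].
rewrite det_diag (bigD1 k) //= big1 => [|i /negPf nik]; rewrite mxE ?eqxx ?nik //.
Qed.

(** Column operations with sources from [k] on preserve the rows before [k], so each row in turn is
    brought to that of the identity by Euclid's algorithm. *)
Lemma letters_generate_low m (A : SLZ n) : (m <= n)%N ->
  (forall (i l : 'I_n), (i < m)%N -> slz_val A i l = (i == l)%:R) -> gen (@letter n) A.
Proof.
have [d] := ubnP (n - m); elim: d m A => // d IHd m A; rewrite ltnS => led.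
rewrite leq_eqVlt => /orP[/eqP -> lowA|lt_mn lowA].
  suff -> : A = 1%g by apply: gen1.
  by apply/val_inj/matrixP => i l; rewrite lowA ?ltn_ord //= mxE.
pose k : 'I_n := Ordinal lt_mn; rewrite -[m]/(nat_of_ord k) in led lowA.
have stepk B : (forall (i l : 'I_n), (i < k.+1)%N -> slz_val B i l = (i == l)%:R) ->
    gen (@letter n) B.
  by move=> lowB; apply: (IHd k.+1 B) => //; have := ltn_ord k; lia.
have [N] := ubnP (\sum_l absz (slz_val A k l))%N.
elim: N A lowA => // N IHN A lowA; rewrite ltnS => leN.
have [[i [e [ki s]]]|[i [j [e [ki nij Ai dij]]]]] := euclid_row lowA; last first.
  rewrite -[A](mulgK (elem i j e)); apply: genMr; last by apply/letterV/letter_elem.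
  apply: IHN => [r l rk|].
    rewrite slz_mulE mul_elem // !lowA //; have /negPf -> : r != i.
      by apply: contraTneq rk => ->; rewrite -leqNgt.
    by rewrite mulr0 mul0rn addr0.
  apply: leq_trans leN; rewrite (bigD1 j) //= [X in (_ < X)%N](bigD1 j) //=.
  rewrite -addSn leq_add //; last first.
    by apply: leq_sum => l nlj; rewrite mul_elem // (negPf nlj) mulr0n addr0.
  by rewrite mul_elem // eqxx mulr1n; lia.
have [ltkn|lenk] := ltnP k.+1 n.
  have [w wk sw] := wfix_trans e ltkn ki.
  rewrite -[A](mulgVK w); apply: genMr; last exact: letter_orth (wfix_orth wk).
  apply: stepk => r l; rewrite ltnS leq_eqVlt => /orP[/eqP/val_inj ->|rk]; apply: row_divg => q.
    by rewrite (signed_rowE _ s) (signed_rowE _ sw).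
  by rewrite lowA // (wfixE _ wk).
have eik : i = k by apply: ord_inj; have := ltn_ord i; lia.
have ekn : k.+1 = n by have := ltn_ord k; lia.
rewrite eik in s; have := flip_last_det ekn lowA; case: e s => [-> //|s _].
apply: stepk => r l; rewrite ltnS leq_eqVlt => /orP[/eqP/val_inj ->|]; last exact: lowA.
by rewrite (signed_rowE _ s) eq_sym.
Qed.

Lemma letters_generate (A : SLZ n) : exists2 u, all (@letter n) u & wprod u = A.
Proof.
have : gen (@letter n) A by apply: (@letters_generate_low 0).
elim=> [|h x _ [u lu <-] lx]; first by exists [::].
by exists (rcons u x); rewrite ?all_rcons ?lx // wprod_rcons.
Qed.

(** Letters have entries -1, 0 and 1, here ['I_3] shifted by one; this gives a finite enumeration to
    filter. *)
Definition small_mx : seq 'M[int]_n :=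
  [seq map_mx (fun c : 'I_3 => c%:Z - 1) B | B <- enum {: 'M['I_3]_n}].

Definition letters : seq (SLZ n) := undup [seq x <- pmap insub small_mx | letter x].

Lemma mem_letters x : (x \in letters) = letter x.
Proof.
rewrite mem_undup mem_filter andb_idr // => lx; rewrite mem_pmap; apply/mapP.
exists (slz_val x); last by rewrite valK.
have small i j : exists c : 'I_3, slz_val x i j = c%:Z - 1.
  have sgb_small e : exists c : 'I_3, sgb e = c%:Z - 1.
    by case: e; [exists ord0 | exists ord_max].
  have small0 : exists c : 'I_3, 0 = c%:Z - 1 by exists (inord 1); rewrite inordK.
  case/orP: lx => [ox|/existsP[a] /existsP[b] /existsP[e] /andP[nab /eqP ->]].
    have [j' [e s]] := orth_row i ox; rewrite (signed_rowE _ s).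
    by case: (j == j'); rewrite ?mulr1n ?mulr0n.
  rewrite val_elem // !mxE; have [->|] := eqVneq i j.
    have /negPf -> : ~~ ((j == a) && (j == b)).
      by apply: contra nab => /andP[/eqP <- /eqP <-].
    by rewrite mulr0 addr0; exists ord_max.
  by case: (_ && _); rewrite add0r ?mulr1 ?mulr0.
have {}small i j : exists c : 'I_3, slz_val x i j == c%:Z - 1.
  by have [c ->] := small i j; exists c.
apply/mapP; exists (\matrix_(i, j) xchoose (small i j)); first by rewrite mem_enum.
by apply/matrixP => i j; rewrite !mxE; apply/eqP/(xchooseP (small i j)).
Qed.

End Generation.

Local Close Scope ring_scope.

(** * Partial recursive functions *)

(** Lists instead of tuples let the arity change through [head] and [behead] without casts; only
    lists of length [k] matter. Predicates count as functions with values 0 and 1. *)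
Definition recursive k (F : seq nat -> nat) : Prop :=
  exists f : recfun k, forall v : k.-tuple nat, computes f v (F v).

Lemma rec_ext k F G : (forall s, size s = k -> F s = G s) -> recursive k F -> recursive k G.
Proof. by move=> E [f fF]; exists f => v; rewrite -E ?size_tuple. Qed.

Lemma rec_subst k F (Gs : seq (seq nat -> nat)) : recursive (size Gs) F ->
  (forall i, (i < size Gs)%N -> recursive k (nth (fun _ => 0) Gs i)) ->
  recursive k (fun s => F [seq G s | G <- Gs]).
Proof.
move=> [f fF] GsC; have /fin_all_exists[gs gsP] : forall i : 'I_(size Gs),
    exists g : recfun k, forall v : k.-tuple nat,
      computes g v (nth (fun _ => 0) Gs i v) by move=> i; apply: GsC.
exists (RComp f gs) => v /=; exists (map_tuple (fun G : seq nat -> nat => G v) (in_tuple Gs)).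
split=> [i|]; last exact: fF.
by rewrite (tnth_nth 0) /= (nth_map (fun _ => 0)).
Qed.

Lemma rec_nth k i : i < k -> recursive k (fun s => nth 0 s i).
Proof. by move=> lt_ik; exists (RProj (Ordinal lt_ik)) => v /=; rewrite (tnth_nth 0). Qed.

Lemma rec_head k : recursive k.+1 (head 0).
Proof. by apply: (rec_ext _ (rec_nth (ltn0Sn k))) => -[]. Qed.

Lemma rec_substE k m F H (Gs : seq (seq nat -> nat)) : recursive m F -> size Gs = m ->
  (forall i, (i < m)%N -> recursive k (nth (fun _ => 0) Gs i)) ->
  (forall s, size s = k -> F [seq G s | G <- Gs] = H s) -> recursive k H.
Proof. by move=> CF sz CGs E; subst m; apply: rec_ext E (rec_subst CF CGs). Qed.

Definition projs (m k : nat) : seq (seq nat -> nat) :=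
  [seq (fun s : seq nat => nth 0 s i) | i <- iota m k].

Lemma size_projs m k : size (projs m k) = k.
Proof. by rewrite size_map size_iota. Qed.

Lemma rec_projs m k i : i < k -> recursive (m + k) (nth (fun _ => 0) (projs m k) i).
Proof.
move=> ik; rewrite (nth_map 0) ?size_iota // nth_iota //.
by apply: rec_nth; rewrite ltn_add2l.
Qed.

Lemma projsE m k s : size s = m + k -> [seq G s | G <- projs m k] = drop m s.
Proof.
move=> sz; rewrite -map_comp; apply: (@eq_from_nth _ 0).
  by rewrite size_map size_iota size_drop sz addKn.
move=> i; rewrite size_map size_iota => ik.
by rewrite (nth_map 0) ?size_iota // nth_iota // nth_drop.
Qed.

Lemma rec_weak k F : recursive k F -> recursive k.+1 (fun s => F (behead s)).
Proof.
move=> CF; apply: (rec_substE CF (size_projs 1 k)) => [|s sz].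
  exact: (@rec_projs 1 k).
by rewrite projsE // drop1.
Qed.

Lemma rec_weak2 k F : recursive k F ->
  recursive k.+2 (fun s => F (behead (behead s))).
Proof. by move=> CF; apply: (rec_weak (rec_weak CF)). Qed.

(** Serves the bodies of bounded loops, which read the counter and the parameters but skip the
    accumulated value in between. *)
Lemma rec_weak1 k F : recursive k.+1 F ->
  recursive k.+2 (fun s => F (head 0 s :: behead (behead s))).
Proof.
move=> CF; apply: (@rec_substE _ _ _ _ (head 0 :: projs 2 k) CF) => [|[|i] ik|s sz] /=.
- by rewrite size_projs.
- exact: rec_head.
- exact: (@rec_projs 2 k).
- by rewrite projsE //; case: s {sz} => [|x [|y s]] //=; rewrite drop0.
Qed.

Lemma rec_succ k A : recursive k A -> recursive k (fun s => (A s).+1).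
Proof.
move=> CA; have CS : recursive 1 (fun s => (head 0 s).+1).
  by exists RSucc => v /=; rewrite /thead (tnth_nth 0) nth0.
by apply: (@rec_subst k _ [:: A] CS) => -[].
Qed.

Lemma rec_const k c : recursive k (fun _ => c).
Proof.
elim: c => [|c IHc]; last exact: rec_succ.
by have := @rec_subst k (fun _ => 0) [::]; apply=> //; exists RZero.
Qed.

Lemma rec_iteri k A b G : recursive k A -> recursive k b ->
  recursive k.+2 (fun s => G (behead (behead s)) (head 0 s) (head 0 (behead s))) ->
  recursive k (fun s => iteri (b s) (G s) (A s)).
Proof.
move=> [fA CA] Cb [fG CG].
have CR : recursive k.+1 (fun s => iteri (head 0 s) (G (behead s)) (A (behead s))).
  exists (RPrec fA fG) => v /=.
  exists (fun i => iteri i (G (behead v)) (A (behead v))); split.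
  - exact: (CA [tuple of behead v]).
  - by move=> i _; apply: (CG [tuple of i :: iteri i _ _ :: behead v]).
  - by rewrite /thead (tnth_nth 0) nth0.
apply: (@rec_substE _ _ _ _ (b :: projs 0 k) CR) => [|[|i] ik|s sz] //=.
- by rewrite size_projs.
- exact: (@rec_projs 0 k).
- by rewrite projsE // drop0.
Qed.

Lemma rec_add k A B : recursive k A -> recursive k B -> recursive k (fun s => A s + B s).
Proof.
move=> CA CB; apply: (rec_ext _
  (@rec_iteri k A B (fun _ _ r => r.+1) CA CB
    ((rec_succ (rec_weak (rec_head _)))))) => s _.
by elim: (B s) => [|n IHn] /=; rewrite ?addn0 // IHn addnS.
Qed.

Lemma rec_pred k A : recursive k A -> recursive k (fun s => (A s).-1).
Proof.
move=> CA; apply: (rec_ext _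
  (@rec_iteri k _ A (fun _ i _ => i) (rec_const k 0) CA (rec_head _))) => s _.
by case: (A s).
Qed.

Lemma rec_sub k A B : recursive k A -> recursive k B -> recursive k (fun s => A s - B s).
Proof.
move=> CA CB; apply: (rec_ext _ (@rec_iteri k A B (fun _ _ r => r.-1) CA CB
  (rec_pred (rec_weak (rec_head _))))) => s _.
by elim: (B s) => [|n IHn] /=; rewrite ?subn0 // IHn subnS.
Qed.

Lemma rec_mul k A B : recursive k A -> recursive k B -> recursive k (fun s => A s * B s).
Proof.
move=> CA CB; apply: (rec_ext _
  (@rec_iteri k _ B (fun s _ r => r + A s) (rec_const k 0) CB
    ((rec_add (rec_weak (rec_head _)) (rec_weak (rec_weak CA)))))) => s _.
by elim: (B s) => [|n IHn] /=; rewrite ?muln0 // IHn mulnS addnC.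
Qed.

Lemma rec_expn2 k A : recursive k A -> recursive k (fun s => 2 ^ A s).
Proof.
move=> CA; apply: (rec_ext _
  (@rec_iteri k _ A (fun _ _ r => r + r) (rec_const k 1) CA
    ((rec_add (rec_weak (rec_head _)) (rec_weak (rec_head _)))))) => s _.
by elim: (A s) => [|n IHn] //=; rewrite IHn expnS mul2n addnn.
Qed.

Lemma rec_negb k (P : seq nat -> bool) :
  recursive k (fun s => P s) -> recursive k (fun s => ~~ P s).
Proof.
move=> CP; apply: (rec_ext _ (rec_sub (rec_const k 1) CP)) => s _.
by case: (P s).
Qed.

Lemma rec_andb k (P Q : seq nat -> bool) :
  recursive k (fun s => P s) -> recursive k (fun s => Q s) -> recursive k (fun s => P s && Q s).
Proof.
by move=> CP CQ; apply: (rec_ext _ (rec_mul CP CQ)) => s _; rewrite mulnb.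
Qed.

Lemma rec_orb k (P Q : seq nat -> bool) :
  recursive k (fun s => P s) -> recursive k (fun s => Q s) -> recursive k (fun s => P s || Q s).
Proof.
move=> CP CQ; apply: (rec_ext _ (rec_negb (rec_andb (rec_negb CP) (rec_negb CQ)))).
by move=> s _; rewrite negb_and !negbK.
Qed.

Lemma rec_leq k A B : recursive k A -> recursive k B -> recursive k (fun s => A s <= B s).
Proof.
move=> CA CB; apply: (rec_ext _ (rec_sub (rec_const k 1) (rec_sub CA CB))) => s _.
by rewrite -subn_eq0; case: (A s - B s).
Qed.

Lemma rec_eqn k A B : recursive k A -> recursive k B -> recursive k (fun s => A s == B s).
Proof.
move=> CA CB; apply: (rec_ext _ (rec_andb (rec_leq CA CB) (rec_leq CB CA))) => s _.
by rewrite eqn_leq.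
Qed.

Lemma rec_if k (P : seq nat -> bool) A B :
  recursive k (fun s => P s) -> recursive k A -> recursive k B ->
  recursive k (fun s => if P s then A s else B s).
Proof.
move=> CP CA CB.
apply: (rec_ext _ (rec_add (rec_mul CP CA) (rec_mul (rec_negb CP) CB))) => s _.
by case: (P s); rewrite /= ?mul1n ?mul0n ?addn0.
Qed.

Lemma rec_ifb k (P Q Q' : seq nat -> bool) : recursive k (fun s => P s) ->
  recursive k (fun s => Q s) -> recursive k (fun s => Q' s) ->
  recursive k (fun s => if P s then Q s else Q' s : bool).
Proof.
by move=> CP CQ CQ'; apply: (rec_ext _ (rec_if CP CQ CQ')) => s _; case: (P s).
Qed.

Lemma rec_all k b (P : seq nat -> nat -> bool) : recursive k b ->
  recursive k.+1 (fun s => P (behead s) (head 0 s)) ->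
  recursive k (fun s => all (P s) (iota 0 (b s))).
Proof.
move=> Cb CP.
have C2 : recursive k.+2 (fun s => P (behead (behead s)) (head 0 s)) := rec_weak1 CP.
apply: (rec_ext _
  (@rec_iteri k _ b (fun s i r => P s i * r) (rec_const k 1) Cb
    ((rec_mul C2 (rec_weak (rec_head _)))))) => s _.
elim: (b s) => [|n IHn] //; rewrite [iteri _ _ _]/= IHn mulnb.
by rewrite -(addn1 n) iotaD all_cat /= andbT andbC.
Qed.

Lemma rec_has k b (P : seq nat -> nat -> bool) : recursive k b ->
  recursive k.+1 (fun s => P (behead s) (head 0 s)) ->
  recursive k (fun s => has (P s) (iota 0 (b s))).
Proof.
move=> Cb CP; have := @rec_all k b (fun s i => ~~ P s i) Cb (rec_negb CP).
move/rec_negb/rec_ext; apply=> s _; congr nat_of_bool.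
by rewrite -has_predC; apply: eq_has => i /=; rewrite negbK.
Qed.

Lemma find_iota n (P : pred nat) : find P (iota 0 n.+1) =
  if (find P (iota 0 n) == n) && ~~ P n then n.+1 else find P (iota 0 n).
Proof.
rewrite -[n.+1 in LHS]addn1 iotaD find_cat size_iota /= add0n.
have [hP|nP] := boolP (has P (iota 0 n)).
  by move: hP; rewrite has_find size_iota => lt; rewrite (ltn_eqF lt).
rewrite hasNfind // size_iota eqxx /=; by case: (P n); rewrite ?addn0 ?addn1.
Qed.

Lemma rec_find k b (P : seq nat -> nat -> bool) : recursive k b ->
  recursive k.+1 (fun s => P (behead s) (head 0 s)) ->
  recursive k (fun s => find (P s) (iota 0 (b s))).
Proof.
move=> Cb CP.
(* The accumulator equals the counter until a solution is met, and stays there from then on. *)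
pose G s i r := if (r == i) && ~~ P s i then i.+1 else r.
have CG : recursive k.+2 (fun s => G (behead (behead s)) (head 0 s) (head 0 (behead s))).
  have C1 := rec_weak (rec_head k); have C0 := rec_head k.+1.
  have CT := rec_andb (rec_eqn C1 C0) (rec_negb (rec_weak1 CP)).
  exact: (rec_if CT (rec_succ C0) C1).
apply: (rec_ext _ (rec_iteri (rec_const k 0) Cb CG)) => s _.
by elim: (b s) => [|n IHn] //; rewrite find_iota -IHn.
Qed.

Lemma rec_all_seq k (T : Type) (l : seq T) (P : T -> seq nat -> bool) :
  (forall x, recursive k (fun s => P x s)) -> recursive k (fun s => all (fun x => P x s) l).
Proof. by move=> CP; elim: l => [|x l IHl] /=; [apply: rec_const | apply: rec_andb]. Qed.

Lemma rec_has_seq k (T : Type) (l : seq T) (P : T -> seq nat -> bool) :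
  (forall x, recursive k (fun s => P x s)) -> recursive k (fun s => has (fun x => P x s) l).
Proof. by move=> CP; elim: l => [|x l IHl] /=; [apply: rec_const | apply: rec_orb]. Qed.

Lemma rec_sum k (T : Type) (l : seq T) (F : T -> seq nat -> nat) :
  (forall x, recursive k (F x)) -> recursive k (fun s => \sum_(x <- l) F x s).
Proof.
move=> CF; elim: l => [|x l IHl].
  by apply: (rec_ext _ (rec_const k 0)) => s _; rewrite big_nil.
by apply: (rec_ext _ (rec_add (CF x) IHl)) => s _; rewrite big_cons.
Qed.

Lemma rec_foldl k (T : Type) (l : seq T) (F : seq nat -> nat -> T -> nat) A : recursive k A ->
  (forall x A, recursive k A -> recursive k (fun s => F s (A s) x)) ->
  recursive k (fun s => foldl (F s) (A s) l).
Proof. by move=> CA CF; elim: l A CA => [|x l IHl] A CA //=; apply: IHl; apply: CF. Qed.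

(** [CodeSeq.code (v :: s)] is 2 ^ v times the odd number [(CodeSeq.code s).*2.+1], and both [v] and
    the code of [s] are smaller than it, so bounded search recovers them. On the code 0 of the empty
    list the range is empty and the result is 0. *)
Definition hdc c := find (fun x => has (fun y => 2 ^ x * y.*2.+1 == c) (iota 0 c)) (iota 0 c).
Definition tlc c := find (fun y => 2 ^ hdc c * y.*2.+1 == c) (iota 0 c).
Definition nthc c i := hdc (iteri i (fun _ => tlc) c).

Lemma find_iota_uniq (P : pred nat) v n : (forall x, P x -> x = v) -> P v -> v < n ->
  find P (iota 0 n) = v.
Proof.
move=> uP Pv lt_vn; have hP : has P (iota 0 n).
  by apply/hasP; exists v => //; rewrite mem_iota.
have := nth_find 0 hP; rewrite has_find size_iota in hP.
by rewrite nth_iota // add0n => /uP.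
Qed.

Lemma code_cons_inj x y v s : 2 ^ x * y.*2.+1 = CodeSeq.code (v :: s) ->
  x = v /\ y = CodeSeq.code s.
Proof.
rewrite -[y in LHS](CodeSeq.decodeK y) => /(can_inj CodeSeq.codeK (x1 := x :: _)) [-> <-].
by rewrite CodeSeq.decodeK.
Qed.

Lemma code_cons_bounds v s : v < CodeSeq.code (v :: s) /\ CodeSeq.code s < CodeSeq.code (v :: s).
Proof.
have := CodeSeq.ltn_code (v :: s) => /andP[-> _]; split=> //=.
apply: (@leq_trans (CodeSeq.code s).*2.+1); first by rewrite ltnS -addnn leq_addr.
by rewrite leq_pmull ?expn_gt0.
Qed.

Lemma hdc_code s : hdc (CodeSeq.code s) = head 0 s.
Proof.
case: s => [|v s] //; have [ltv lts] := code_cons_bounds v s.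
apply: find_iota_uniq => // [x /hasP[y _ /eqP/code_cons_inj[]] //|].
by apply/hasP; exists (CodeSeq.code s); rewrite ?mem_iota.
Qed.

Lemma tlc_code s : tlc (CodeSeq.code s) = CodeSeq.code (behead s).
Proof.
case: s => [|v s] //; have [ltv lts] := code_cons_bounds v s.
by rewrite /tlc hdc_code; apply: find_iota_uniq => // y /eqP/code_cons_inj[].
Qed.

Lemma nthc_code s i : nthc (CodeSeq.code s) i = nth 0 s i.
Proof.
rewrite -[in RHS](addn0 i) -nth_drop nth0 -hdc_code; congr hdc.
elim: i => [|i IHi] /=; first by rewrite drop0.
by rewrite IHi tlc_code -drop1 drop_drop add1n.
Qed.

Lemma rec_double k A : recursive k A -> recursive k (fun s => (A s).*2).
Proof. by move=> CA; apply: (rec_ext _ (rec_add CA CA)) => s _; rewrite addnn. Qed.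

Lemma rec_hdc k A : recursive k A -> recursive k (fun s => hdc (A s)).
Proof.
move=> CA; apply: (rec_find CA); apply: rec_has (rec_weak CA) _.
apply: rec_eqn; last exact: rec_weak (rec_weak CA).
apply: rec_mul; first exact: rec_expn2 (rec_weak (rec_head _)).
exact: rec_succ (rec_double (rec_head _)).
Qed.

Lemma rec_tlc k A : recursive k A -> recursive k (fun s => tlc (A s)).
Proof.
move=> CA; apply: (rec_find CA).
apply: rec_eqn; last exact: rec_weak CA.
apply: rec_mul; first exact: rec_expn2 (rec_weak (rec_hdc CA)).
exact: rec_succ (rec_double (rec_head _)).
Qed.

Lemma rec_nthc k A B : recursive k A -> recursive k B -> recursive k (fun s => nthc (A s) (B s)).
Proof.
move=> CA CB; apply: rec_hdc; apply: (rec_iteri CA CB).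
exact: rec_tlc (rec_weak (rec_head _)).
Qed.

(** Minimization of the negated check stops at the least accepted certificate; its head, 0 or not,
    is the answer. *)
Lemma rec_decide (chk : nat -> nat -> nat -> bool) :
  recursive 3 (fun s => chk (nth 0 s 0) (nth 0 s 1) (nth 0 s 2)) ->
  exists f : recfun 2, forall a b, (exists y, chk y a b) ->
    exists2 y, chk y a b & computes f [tuple a; b] (hdc y == 0).
Proof.
move=> /rec_negb[fc fcP].
have [fo foP] := rec_eqn (rec_hdc (rec_head 0)) (rec_const 1 0).
exists (RComp fo (fun _ : 'I_1 => RMu fc)) => a b ex.
have [y chk_y miny] := ex_minnP ex; exists y => //=.
exists [tuple y]; split; last exact: foP.
move=> i; rewrite (tnth_nth 0) ord1 /=; split=> [|j lt_jy].
  have /= := fcP [tuple y; a; b]; rewrite chk_y /= => H.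
  by rewrite (_ : [tuple of _ :: _] = [tuple y; a; b]) //; apply: val_inj.
exists 0; have /= := fcP [tuple j; a; b].
have -> : chk j a b = false by apply: contraTF lt_jy => /miny; rewrite -leqNgt.
by move=> H; rewrite (_ : [tuple of _ :: _] = [tuple j; a; b]) //; apply: val_inj.
Qed.

(** * Permutation tables and cosets *)

Section Tables.
Variable n : nat.
Hypothesis n_gt0 : (0 < n)%N.

(** In the product of SL(n,Z) with the symmetric group, lifted by the graph of [phi], a word is
    trivial when both components are; the first projection is the required homomorphism. *)
Lemma perm_words_trivial (T : finType) (phi : SLZ n -> {perm T}) :
  (forall u, all (@letter n) u -> size u <= 5 -> wprod u = 1%g ->
     wprod (map phi u) = 1%g) ->
  forall u, all (@letter n) u -> wprod u = 1%g -> wprod (map phi u) = 1%g.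
Proof.
move=> short u lu u1; pose lift x : SLZ n * {perm T} := (x, phi x).
have liftE v : wprod (map lift v) = (wprod v, wprod (map phi v)).
  by elim: v => //= x v ->.
have /(congr1 snd) : wprod (map lift u) = 1%g.
  apply: (@words_trivial n _ fst lift) => // v lv sv v1.
  by rewrite liftE v1 (short v lv sv v1).
by rewrite liftE.
Qed.

Let Ls := letters n.
Let N := size Ls.

Definition lnth (b : nat) : SLZ n := nth 1%g (letters n) b.
Definition eval (w : seq nat) : SLZ n := wprod (map lnth w).
Definition is_word (w : seq nat) := all (fun b => b < size (letters n)) w.
Definition run (tau : nat -> nat -> nat) c w := foldl (fun c b => tau b c) c w.

Lemma eval_cat u v : eval (u ++ v) = (eval u * eval v)%g.
Proof. by rewrite /eval map_cat wprod_cat. Qed.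

Lemma run_cat tau c u v : run tau c (u ++ v) = run tau (run tau c u) v.
Proof. exact: foldl_cat. Qed.

Lemma is_word_cat u v : is_word (u ++ v) = is_word u && is_word v.
Proof. exact: all_cat. Qed.

Definition lidx (x : SLZ n) := index x (letters n).

Lemma lidxK x : letter x -> lnth (lidx x) = x.
Proof. by move=> lx; apply: nth_index; rewrite mem_letters. Qed.

Lemma lidx_lt x : letter x -> lidx x < N.
Proof. by move=> lx; rewrite index_mem mem_letters. Qed.

Lemma lnthK b : b < N -> lidx (lnth b) = b.
Proof. by move=> bN; rewrite /lidx index_uniq ?undup_uniq. Qed.

Lemma lnth_letter b : b < N -> letter (lnth b).
Proof. by move=> bN; rewrite -mem_letters mem_nth. Qed.

Lemma word_exists x : exists2 w, is_word w & eval w = x.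
Proof.
have [u lu <-] := letters_generate x; exists (map lidx u).
  by rewrite /is_word all_map; apply: sub_all lu => y /lidx_lt.
rewrite /eval -map_comp; congr wprod; rewrite -[RHS]map_id.
by apply/eq_in_map => y /(allP lu) /lidxK.
Qed.

Definition word_inv w := rev [seq lidx (lnth b)^-1%g | b <- w].

Lemma word_invP w : is_word w -> is_word (word_inv w) /\ eval (word_inv w) = (eval w)^-1%g.
Proof.
move=> ww; split.
  rewrite /is_word /word_inv all_rev all_map; apply: sub_all ww => b bN /=.
  by apply: lidx_lt; apply: letterV; apply: lnth_letter.
rewrite /eval -wprod_inv /winv /word_inv map_rev; congr (wprod (rev _)).
rewrite -!map_comp; apply/eq_in_map => b /(allP ww) bN /=.
by rewrite lidxK //; apply: letterV; apply: lnth_letter.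
Qed.

Definition short_words : seq (seq nat) :=
  [seq map val (tval t) | s <- iota 0 6, t <- enum {: s.-tuple 'I_(size (letters n))}].

Definition relators := [seq w <- short_words | eval w == 1%g].

Lemma mem_relators w : w \in relators = [&& is_word w, size w <= 5 & eval w == 1%g].
Proof.
rewrite mem_filter andbC andbA; congr andb; apply/allpairsPdep/andP.
  move=> [s [t [sS _ ->]]]; rewrite /is_word all_map size_map size_tuple.
  by split; [apply/allP => i _ /= | rewrite mem_iota in sS].
move=> [ww sw]; have szt : size (pmap (insub : nat -> option 'I_(size (letters n))) w) == size w.
  by rewrite size_pmap_sub -all_count.
exists (size w), (Tuple szt); split; rewrite ?mem_iota ?mem_enum //=.
rewrite pmap_filter //; last exact: insubK.
by apply/esym/all_filterP; apply: sub_all ww => b; rewrite isSome_insub.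
Qed.

(** Each letter permutes the points below [m], because a letter followed by its inverse is a relator
    of length 2. *)
Definition good_table m tau :=
  (forall b c, b < N -> c < m -> tau b c < m) /\
  (forall r c, r \in relators -> c < m -> run tau c r = c).

Lemma good_table_trivial m tau w c : good_table m tau -> is_word w -> eval w = 1%g ->
  c < m -> run tau c w = c.
Proof.
move=> [tau_lt tau_rel] ww w1 cm.
have relV b : b < N -> [:: b; lidx (lnth b)^-1%g] \in relators.
  move=> bN; have lb := letterV (lnth_letter bN).
  by rewrite mem_relators /is_word /eval /= bN lidx_lt //= mulg1 lidxK // mulgV.
(* On letters the default is never taken: [phiE] shows that the table of a letter is a
   permutation. *)
pose phi x : {perm 'I_m} :=
  odflt 1%g [pick s : {perm 'I_m} | [forall c, val (s c) == tau (lidx x) (val c)]].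
have phiE b (d : 'I_m) : b < N -> val (phi (lnth b) d) = tau b (val d).
  move=> bN; rewrite /phi lnthK //; case: pickP => [s /forallP/(_ d)/eqP //|no].
  pose f (d : 'I_m) := Ordinal (tau_lt _ _ bN (ltn_ord d)).
  have f_inj : injective f.
    move=> d1 d2 /(congr1 val) /= E; apply: val_inj => /=.
    have r1 := tau_rel _ _ (relV _ bN) (ltn_ord d1).
    have r2 := tau_rel _ _ (relV _ bN) (ltn_ord d2).
    by rewrite -r1 -r2 /= E.
  by have /forallP[] := no (perm f_inj); move=> d'; rewrite permE.
have runE u (d : 'I_m) : is_word u ->
    val (wprod (map phi (map lnth u)) d) = run tau (val d) u.
  elim: u d => [d _|b u IHu d /= /andP[bN wu]]; first by rewrite perm1.
  by rewrite permM IHu // phiE.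
suff phi1 : wprod (map phi (map lnth w)) = 1%g.
  by have := runE w (Ordinal cm) ww; rewrite phi1 perm1.
apply: perm_words_trivial w1 => [u lu su u1|]; last first.
  by rewrite all_map; apply: sub_all ww => b /lnth_letter.
apply/permP => d; rewrite perm1; apply: val_inj.
have wu : is_word (map lidx u) by rewrite /is_word all_map; apply: sub_all lu => y /lidx_lt.
have eu : map lnth (map lidx u) = u.
  by rewrite -map_comp -[RHS]map_id; apply/eq_in_map => y /(allP lu) /lidxK.
rewrite -[in LHS]eu runE //; apply: tau_rel (ltn_ord d).
by rewrite mem_relators wu size_map su /eval eu u1 /=.
Qed.

Lemma good_table_eval m tau u v c : good_table m tau -> is_word u -> is_word v ->
  eval u = eval v -> c < m -> run tau c u = run tau c v.
Proof.
move=> gt wu wv E cm; have [wv' ev'] := word_invP wv.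
have run_lt w d : is_word w -> d < m -> run tau d w < m.
  elim: w d => //= b w IHw d /andP[bN ww] dm; apply: IHw => //.
  by case: gt => tau_lt _; apply: tau_lt.
transitivity (run tau c (u ++ word_inv v ++ v)).
  rewrite run_cat (good_table_trivial gt (w := word_inv v ++ v)) ?run_lt //.
    by rewrite is_word_cat wv' wv.
  by rewrite eval_cat ev' mulVg.
rewrite catA run_cat (good_table_trivial gt (w := u ++ word_inv v)) //.
  by rewrite is_word_cat wu wv'.
by rewrite eval_cat ev' E mulgV.
Qed.

(** * The table of the action on the cosets of a finite index subgroup *)

Section Cosets.
Variable H : set (SLZ n).
Hypothesis H_group : is_subgroup H.
Hypothesis H_index : finite_index H.

Local Open Scope classical_set_scope.

(** The inverse turns left multiplication into a right action on left cosets, matching [run], which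
    reads words from the left. *)
Definition act (x : SLZ n) (C : set (SLZ n)) : set (SLZ n) := [set (x^-1 * h)%g | h in C].

Lemma act1 C : act 1%g C = C.
Proof.
apply/seteqP; split=> [x [h Ch <-]|x Cx]; first by rewrite invg1 mul1g.
by exists x => //; rewrite invg1 mul1g.
Qed.

Lemma actM x y C : act (x * y)%g C = act y (act x C).
Proof.
apply/seteqP; split=> [z [h Ch <-]|z [_ [h Ch <-] <-]].
  by exists (x^-1 * h)%g; [exists h | rewrite invgM mulgA].
by exists h => //; rewrite invgM mulgA.
Qed.

Lemma act_coset x C : left_cosets H C -> left_cosets H (act x C).
Proof.
move=> [y ->]; exists (x^-1 * y)%g; apply/seteqP; split=> [z [_ [h Hh <-] <-]|z [h Hh <-]].
  by exists h; rewrite ?mulgA.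
by exists (y * h)%g; [exists h | rewrite mulgA].
Qed.

Lemma act_fix x : H x <-> act x H = H.
Proof.
have [H1 HM HV] := H_group; split=> [Hx|E].
  apply/seteqP; split=> [z [h Hh <-]|z Hz]; first by apply: HM => //; apply: HV.
  by exists (x * z)%g; [apply: HM | rewrite mulKg].
have : act x H x^-1%g by exists 1%g; rewrite ?mulg1.
by rewrite E => /HV; rewrite invgK.
Qed.

Lemma coset_table : exists m tau c0, [/\ good_table m tau, c0 < m &
  forall w, is_word w -> (run tau c0 w == c0) <-> H (eval w)].
Proof.
have /finite_seqP[s0 E0] := H_index; pose s := undup s0.
have Es C : left_cosets H C <-> C \in s by rewrite E0 mem_undup.
have HH : H \in s.
  apply/Es; exists 1%g; apply/seteqP; split=> [z Hz|z [h Hh <-]]; last by rewrite mul1g.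
  by exists z; rewrite ?mul1g.
pose tau b c := index (act (lnth b) (nth set0 s c)) s.
have in_s x C : C \in s -> act x C \in s by move=> /Es/act_coset/Es.
have runE w C : C \in s -> is_word w -> run tau (index C s) w = index (act (eval w) C) s.
  elim: w C => [|b w IHw] C Cs /=; first by rewrite act1.
  by case/andP=> bN ww; rewrite /tau nth_index // -/(tau) IHw ?in_s // -actM.
have idxK c : c < size s -> index (nth set0 s c) s = c.
  by move=> cs; rewrite index_uniq ?undup_uniq.
exists (size s), tau, (index H s); split; rewrite ?index_mem //.
  split=> [b c _ cs|r c]; first by rewrite index_mem; apply/in_s/mem_nth.
  rewrite mem_relators => /and3P[wr _ /eqP r1] cs.
  by rewrite -[in LHS](idxK c cs) runE ?mem_nth // r1 act1 idxK.
move=> w ww; rewrite runE // act_fix; split=> [/eqP E|->//].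
by have := congr1 (nth set0 s) E; rewrite !nth_index ?in_s.
Qed.

End Cosets.

End Tables.

(** * Membership certificates *)

Lemma gen_generated (G : groupType) (S : seq G) (x : G) :
  generated S x <-> gen (fun y => y \in S \/ y^-1%g \in S) x.
Proof.
split=> [|gx A [[A1 AM AV] SA]].
  apply; split=> [|y Sy]; last by apply: gen_in; left.
  split=> [|y z|y]; [exact: gen1 | exact: genM |].
  by apply: genV => z [Sz|Sz]; [right; rewrite invgK | left].
elim: gx => // h y _ Ah [/SA Sy|/SA/AV]; first exact: AM.
by rewrite invgK; apply: AM.
Qed.

Lemma generated_group (G : groupType) (S : seq G) : is_subgroup (generated S).
Proof.
split=> [|x y|x] *.
- by apply/gen_generated; apply: gen1.
- by apply/gen_generated; apply: genM; apply/gen_generated.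
- apply/gen_generated; apply: genV; last exact/gen_generated.
  by move=> z [Sz|Sz]; [right; rewrite invgK | left].
Qed.

Lemma generated_in (G : groupType) (S : seq G) (x : G) : x \in S -> generated S x.
Proof. by move=> Sx; apply/gen_generated/gen_in; left. Qed.

Lemma nth_allpairs (S T R : Type) (f : S -> T -> R) s t x0 y0 z0 i j :
  (i < size s)%N -> (j < size t)%N ->
  nth z0 [seq f x y | x <- s, y <- t] (i * size t + j) = f (nth x0 s i) (nth y0 t j).
Proof.
elim: s i => // x s IHs [|i] lt_is lt_jt; rewrite /= nth_cat size_map.
  by rewrite mul0n add0n lt_jt (nth_map y0).
by rewrite mulSn -addnA ltnNge leq_addr /= addKn IHs.
Qed.

(** * Matrix arithmetic on codes and the verification of certificates *)

Section Codes.
Variable n : nat.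
Hypothesis n_gt0 : (0 < n)%N.

Definition halfc c := find (fun x => (x.*2 == c) || (x.*2.+1 == c)) (iota 0 c).

Lemma halfcE c : halfc c = c./2.
Proof. by case: c => // c; apply: find_iota_uniq => [x||]; lia. Qed.

Lemma rec_halfc k A : recursive k A -> recursive k (fun s => halfc (A s)).
Proof.
move=> CA; apply: rec_find => //; have C2 := rec_double (rec_head k).
by apply: rec_orb; apply: rec_eqn (rec_weak CA) => //; apply: rec_succ.
Qed.

(* The integer coded by [c] is [posc c - negc c]. *)
Definition posc c := if (halfc c).*2 == c then halfc c else 0%N.
Definition negc c := if (halfc c).*2 == c then 0%N else (halfc c).+1.

Lemma rec_posc k A : recursive k A -> recursive k (fun s => posc (A s)).
Proof.
move=> CA; have CH := rec_halfc CA.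
exact: rec_if (rec_eqn (rec_double CH) CA) CH (rec_const _ _).
Qed.

Lemma rec_negc k A : recursive k A -> recursive k (fun s => negc (A s)).
Proof.
move=> CA; have CH := rec_halfc CA.
exact: rec_if (rec_eqn (rec_double CH) CA) (rec_const _ _) (rec_succ CH).
Qed.

Lemma int_codeK z : ((posc (int_code z))%:Z - (negc (int_code z))%:Z)%R = z.
Proof.
rewrite /posc /negc halfcE; case: z => k /=.
  by rewrite doubleK eqxx subr0.
by rewrite uphalf_double (_ : (_ == _) = false) ?sub0r ?NegzE //; lia.
Qed.

Definition entc a (i j : 'I_n) := nthc a (i * n + j).

(* Every number codes a matrix, with missing entries read as [0]. *)
Definition mxc a : 'M[int]_n :=
  \matrix_(i, j) ((posc (entc a i j))%:Z - (negc (entc a i j))%:Z)%R.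

Lemma mx_codeK (A : 'M[int]_n) : mxc (mx_code A) = A.
Proof.
apply/matrixP => i j; rewrite !mxE /entc /mx_code nthc_code.
have -> : nth 0%N [seq int_code (A i' j') | i' <- enum 'I_n, j' <- enum 'I_n] (i * n + j) =
    int_code (A i j); last exact: int_codeK.
have := @nth_allpairs _ _ _ (fun a b => int_code (A a b)) (enum 'I_n) (enum 'I_n) i j 0%N i j.
by rewrite !size_enum_ord !nth_ord_enum => -> //; apply: ltn_ord.
Qed.

(** Negative terms are moved to the other side of each entry's equation, so that only sums and
    products of natural numbers are compared. *)
Definition mulc a b c := all (fun i => all (fun j =>
   (\sum_(k <- enum 'I_n) (posc (entc a i k) * posc (entc b k j) +
      negc (entc a i k) * negc (entc b k j)) + negc (entc c i j) ==
    \sum_(k <- enum 'I_n) (posc (entc a i k) * negc (entc b k j) +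
      negc (entc a i k) * posc (entc b k j)) + posc (entc c i j))%N) (enum 'I_n)) (enum 'I_n).

Lemma mulcP a b c : reflect (mxc c = mxc a *m mxc b)%R (mulc a b c).
Proof.
have E i j : ((mxc a *m mxc b) i j =
    (\sum_(k <- enum 'I_n) (posc (entc a i k) * posc (entc b k j) +
      negc (entc a i k) * negc (entc b k j)))%N%:Z -
    (\sum_(k <- enum 'I_n) (posc (entc a i k) * negc (entc b k j) +
      negc (entc a i k) * posc (entc b k j)))%N%:Z)%R.
  rewrite mxE !big_enum /= -!natz !natr_sum -sumrB; apply: eq_bigr => k _.
  by rewrite !mxE !natz !PoszD !PoszM; ring.
apply: (iffP allP) => [H|H i _]; last first.
  apply/allP => j _; move/matrixP: H => /(_ i j); rewrite E mxE.
  by move: (bigop _ _ _) (bigop _ _ _) => x y /= Exy; apply/eqP; lia.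
apply/matrixP => i j; rewrite E mxE.
have /allP/(_ j (mem_enum _ j))/eqP := H i (mem_enum _ i).
by move: (bigop _ _ _) (bigop _ _ _) => x y /= Exy; lia.
Qed.

Definition eqc a b := all (fun i => all (fun j =>
  posc (entc a i j) + negc (entc b i j) == posc (entc b i j) + negc (entc a i j))%N
  (enum 'I_n)) (enum 'I_n).

Lemma eqcP a b : reflect (mxc a = mxc b) (eqc a b).
Proof.
apply: (iffP allP) => [H|H i _].
  apply/matrixP => i j; rewrite !mxE.
  by have /allP/(_ j (mem_enum _ j))/eqP := H i (mem_enum _ i); lia.
by apply/allP => j _; move/matrixP: H => /(_ i j); rewrite !mxE => ?; apply/eqP; lia.
Qed.

Lemma rec_entc k A i j : recursive k A -> recursive k (fun s => entc (A s) i j).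
Proof. by move=> CA; apply: rec_nthc => //; apply: rec_const. Qed.

Lemma rec_mulc k A B C : recursive k A -> recursive k B -> recursive k C ->
  recursive k (fun s => mulc (A s) (B s) (C s)).
Proof.
move=> CA CB CC; apply: rec_all_seq => i; apply: rec_all_seq => j.
by apply: rec_eqn; apply: rec_add;
  try (apply: rec_sum => l; apply: rec_add; apply: rec_mul);
  (apply: rec_posc || apply: rec_negc); apply: rec_entc.
Qed.

Lemma rec_eqc k A B : recursive k A -> recursive k B -> recursive k (fun s => eqc (A s) (B s)).
Proof.
move=> CA CB; apply: rec_all_seq => i; apply: rec_all_seq => j.
by apply: rec_eqn; apply: rec_add; (apply: rec_posc || apply: rec_negc); apply: rec_entc.
Qed.

(** Separates the codes of actual generators from the value 0 read beyond the end of a coded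
    list. *)
Lemma mx_code_neq0 (A : 'M[int]_n) : mx_code A != 0%N.
Proof.
have : (size [seq int_code (A i j) | i <- enum 'I_n, j <- enum 'I_n] > 0)%N.
  by rewrite size_allpairs size_enum_ord muln_gt0 n_gt0.
by rewrite /mx_code; case: [seq _ | _ <- _, _ <- _] => // x s _; rewrite muln_eq0 expn_eq0.
Qed.

Definition one_code := mx_code (1%:M : 'M[int]_n)%R.

(** [y] codes 0, the length of a path and its partial products. A step by an inverse generator is
    the same product with its ends exchanged. The number [gens] itself bounds the length of the list
    it codes. *)
Definition pos_cert y gens g :=
  let l := nthc y 1 in let ps := nthc y 2 in
  [&& eqc (nthc ps 0) one_code,
      all (fun i => has (fun j => (nthc gens j != 0%N) &&
          (mulc (nthc ps i) (nthc gens j) (nthc ps i.+1) ||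
           mulc (nthc ps i.+1) (nthc gens j) (nthc ps i))) (iota 0 gens)) (iota 0 l) &
      eqc (nthc ps l) g].

Definition tabc t b c := nthc (nthc t b) c.

Definition tend tr := nthc (nthc tr 2) (nthc tr 0).

(** [tr] codes a length, the partial products of a word for [x], and the points it visits from [c0].
    The letters are not recorded: one fitting both lists is searched for at each step. *)
Definition trace t c0 tr x :=
  let l := nthc tr 0 in let ps := nthc tr 1 in let cs := nthc tr 2 in
  [&& eqc (nthc ps 0) one_code, nthc cs 0 == c0,
      all (fun i => has (fun b =>
         mulc (nthc ps i) (mx_code (slz_val (lnth n b))) (nthc ps i.+1) &&
         (nthc cs i.+1 == tabc t b (nthc cs i))) (iota 0 (size (letters n)))) (iota 0 l) &
      eqc (nthc ps l) x].

(** After its head, [y] codes the number of points, the base point, the table, one trace for each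
    generator, and a trace for [g]. *)
Definition neg_cert y gens g :=
  let m := nthc y 1 in let c0 := nthc y 2 in let t := nthc y 3 in
  [&& (c0 < m)%N,
      all (fun b => all (fun c => (tabc t b c < m)%N) (iota 0 m)) (iota 0 (size (letters n))),
      all (fun r => all (fun c => run (tabc t) c r == c) (iota 0 m)) (relators n),
      all (fun i => (nthc gens i == 0%N) ||
         trace t c0 (nthc (nthc y 4) i) (nthc gens i) && (tend (nthc (nthc y 4) i) == c0))
        (iota 0 gens),
      trace t c0 (nthc y 5) g & tend (nthc y 5) != c0].

Definition check y gens g :=
  if hdc y == 0%N then pos_cert y gens g else neg_cert y gens g.

Ltac rec_tac := repeat first
  [ assumption | apply: rec_head | apply: rec_const
  | apply: rec_andb | apply: rec_orb | apply: rec_negb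
  | apply: rec_leq | apply: rec_eqn | apply: rec_eqc | apply: rec_mulc
  | apply: rec_all_seq => ? | apply: rec_has_seq => ?
  | apply: rec_all | apply: rec_has
  | apply: rec_succ | apply: rec_nthc
  | apply: rec_hdc | apply: rec_weak | apply: rec_weak2 ].

Lemma rec_pos_cert k Y A B : recursive k Y -> recursive k A -> recursive k B ->
  recursive k (fun s => pos_cert (Y s) (A s) (B s)).
Proof. by move=> CY CA CB; rewrite /pos_cert; rec_tac. Qed.

Lemma rec_trace k T C R A : recursive k T -> recursive k C -> recursive k R ->
  recursive k A -> recursive k (fun s => trace (T s) (C s) (R s) (A s)).
Proof. by move=> CT CC CR CA; rewrite /trace /tabc; rec_tac. Qed.

Lemma rec_neg_cert k Y A B : recursive k Y -> recursive k A -> recursive k B ->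
  recursive k (fun s => neg_cert (Y s) (A s) (B s)).
Proof.
move=> CY CA CB; rewrite /neg_cert /tend /tabc /run.
apply: rec_andb; first by rec_tac.
apply: rec_andb; first by rec_tac.
apply: rec_andb.
  apply: rec_all_seq => r; apply: rec_all; first by rec_tac.
  apply: rec_eqn; last by rec_tac.
  apply: rec_foldl; first by rec_tac.
  by move=> x C CC; rec_tac.
apply: rec_andb.
  apply: rec_all => //; apply: rec_orb; first by rec_tac.
  by apply: rec_andb; first apply: rec_trace; rec_tac.
by apply: rec_andb; first apply: rec_trace; rec_tac.
Qed.

Lemma rec_check : recursive 3 (fun s => check (nth 0 s 0) (nth 0 s 1) (nth 0 s 2))%N.
Proof.
have [C0 C1 C2] : [/\ recursive 3 (fun s => nth 0 s 0)%N, recursive 3 (fun s => nth 0 s 1)%N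
  & recursive 3 (fun s => nth 0 s 2)%N] by split; apply: rec_nth.
apply: rec_ifb; first by rec_tac.
  exact: rec_pos_cert.
exact: rec_neg_cert.
Qed.

(** * Soundness and completeness of the certificates *)

Lemma nthc_gens (gens : seq (SLZ n)) j : nthc (gens_code gens) j != 0%N ->
  exists2 x, x \in gens & nthc (gens_code gens) j = mx_code (slz_val x).
Proof.
rewrite /gens_code nthc_code; have [le|lt] := leqP (size gens) j.
  by rewrite nth_default ?size_map.
by rewrite (nth_map 1%g) // => _; exists (nth 1%g gens j); rewrite ?mem_nth.
Qed.

Lemma size_code s : (size s <= CodeSeq.code s)%N.
Proof. by elim: s => // v s IHs; have [_] := code_cons_bounds v s; apply: leq_ltn_trans. Qed.

Lemma gens_nthc (gens : seq (SLZ n)) x : x \in gens ->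
  exists2 j, (j < gens_code gens)%N & nthc (gens_code gens) j = mx_code (slz_val x).
Proof.
move=> gx; exists (index x gens).
  by apply: leq_trans (size_code _); rewrite size_map index_mem.
by rewrite /gens_code nthc_code (nth_map 1%g) ?index_mem // nth_index.
Qed.

Lemma pos_cert_sound y gens (g : SLZ n) :
  pos_cert y (gens_code gens) (mx_code (slz_val g)) -> generated gens g.
Proof.
case/and3P => /eqcP p0 /allP steps /eqcP pl.
have [G1 GM GV] := generated_group gens.
have : forall i, (i <= nthc y 1)%N ->
    exists2 x : SLZ n, generated gens x & mxc (nthc (nthc y 2) i) = slz_val x.
  elim=> [_|i IHi lti]; first by exists 1%g; rewrite // p0 /one_code mx_codeK.
  have [x gx ex] := IHi (ltnW lti).
  have := steps i; rewrite mem_iota => /(_ lti)/hasP[j _ /andP[/nthc_gens[s gs ->]]].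
  case/orP=> /mulcP; rewrite mx_codeK ex => E.
    by exists (x * s)%g; [apply: GM => //; apply: generated_in | rewrite E].
  exists (x * s^-1)%g; first by apply: GM => //; apply: GV; apply: generated_in.
  by rewrite /= E mulmxK ?slz_unit.
move=> /(_ _ (leqnn _))[x gx ex]; suff <- : x = g by [].
by apply: val_inj; rewrite /= -ex pl mx_codeK.
Qed.

Lemma generated_path (gens : seq (SLZ n)) g : generated gens g ->
  exists l (p : nat -> SLZ n), [/\ p 0%N = 1%g, p l = g &
    forall i, (i < l)%N -> exists2 s, s \in gens & p i.+1 = (p i * s)%g \/ p i = (p i.+1 * s)%g].
Proof.
move/gen_generated; elim=> [|h x _ [l [p [p0 pl ps]]] gx].
  by exists 0%N, (fun _ => 1%g).
exists l.+1, (fun i => if (i <= l)%N then p i else (h * x)%g); split=> //=.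
  by rewrite ltnn.
move=> i lt_i; have [eil|nil] := eqVneq i l.
  rewrite eil leqnn ltnn pl; case: gx => gx; first by exists x => //; left.
  by exists x^-1%g => //; right; rewrite mulgK.
have lt_il : (i < l)%N by rewrite ltn_neqAle nil -ltnS.
by rewrite (ltnW lt_il) lt_il; apply: ps.
Qed.

Lemma pos_cert_complete gens (g : SLZ n) : generated gens g ->
  exists2 y, hdc y = 0%N & pos_cert y (gens_code gens) (mx_code (slz_val g)).
Proof.
move=> /generated_path[l [p [p0 pl steps]]].
have [ps psE] : exists ps, forall i, (i <= l)%N -> nthc ps i = mx_code (slz_val (p i)).
  exists (CodeSeq.code [seq mx_code (slz_val (p i)) | i <- iota 0 l.+1]) => i le.
  by rewrite nthc_code (nth_map 0%N) ?size_iota // nth_iota.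
exists (CodeSeq.code [:: 0%N; l; ps]); first by rewrite hdc_code.
rewrite /pos_cert !nthc_code [nth _ _ 1]/= [nth _ _ 2]/=; apply/and3P; split.
- by rewrite psE // p0; apply/eqcP; rewrite mx_codeK.
- apply/allP => i; rewrite mem_iota => /= lt_il; apply/hasP.
  have [s gs E] := steps i lt_il; have [j lt_j ej] := gens_nthc gs.
  exists j; first by rewrite mem_iota.
  rewrite ej mx_code_neq0 !psE ?(ltnW lt_il) //; apply/orP.
  by case: E => E; [left | right]; apply/mulcP; rewrite !mx_codeK E.
- by rewrite psE // pl; apply/eqcP.
Qed.

Lemma trace_sound t c0 tr (x : SLZ n) : trace t c0 tr (mx_code (slz_val x)) ->
  exists w, [/\ is_word n w, eval n w = x & run (tabc t) c0 w = tend tr].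
Proof.
case/and4P => /eqcP p0 /eqP c00 /allP steps /eqcP pl.
have : forall i, (i <= nthc tr 0)%N -> exists w, [/\ is_word n w,
    mxc (nthc (nthc tr 1) i) = slz_val (eval n w) & run (tabc t) c0 w = nthc (nthc tr 2) i].
  elim=> [_|i IHi lti]; first by exists [::]; rewrite p0 /one_code mx_codeK.
  have [w [ww ew rw]] := IHi (ltnW lti).
  have := steps i; rewrite mem_iota => /(_ lti)/hasP[b].
  rewrite mem_iota => /= bN /andP[/mulcP E /eqP ec].
  exists (rcons w b); split.
  - by rewrite /is_word all_rcons bN.
  - by rewrite E mx_codeK ew -cats1 eval_cat {3}/eval /= mulmx1.
  - by rewrite -cats1 run_cat rw /= ec.
move=> /(_ _ (leqnn _))[w [ww ew rw]]; exists w; split=> //.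
by apply: val_inj; rewrite /= -ew pl mx_codeK.
Qed.

Definition trace_code tau c0 w := CodeSeq.code [:: size w;
  CodeSeq.code [seq mx_code (slz_val (eval n (take i w))) | i <- iota 0 (size w).+1];
  CodeSeq.code [seq run tau c0 (take i w) | i <- iota 0 (size w).+1]].

Lemma tend_trace_code tau c0 w : tend (trace_code tau c0 w) = run tau c0 w.
Proof.
have tendE a b c : tend (CodeSeq.code [:: a; b; c]) = nthc c a by rewrite /tend !nthc_code.
by rewrite tendE nthc_code (nth_map 0%N) ?size_iota // nth_iota // take_size.
Qed.

Lemma trace_complete m tau t c0 w : good_table n m tau ->
  (forall b c, (b < size (letters n))%N -> (c < m)%N -> tabc t b c = tau b c) ->
  (c0 < m)%N -> is_word n w ->
  trace t c0 (trace_code tau c0 w) (mx_code (slz_val (eval n w))).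
Proof.
move=> gt tE c0m ww.
have run_lt u d : is_word n u -> (d < m)%N -> (run tau d u < m)%N.
  elim: u d => //= b u IHu d /andP[bN wu] dm; apply: IHu => //.
  by case: gt => tau_lt _; apply: tau_lt.
have nthc_seq (F : nat -> nat) i : (i <= size w)%N ->
    nthc (CodeSeq.code [seq F i | i <- iota 0 (size w).+1]) i = F i.
  by move=> le; rewrite nthc_code (nth_map 0%N) ?size_iota // nth_iota.
have psE := nthc_seq (fun i => mx_code (slz_val (eval n (take i w)))).
have csE := nthc_seq (fun i => run tau c0 (take i w)).
rewrite /trace /trace_code; move: psE csE.
move: (CodeSeq.code (map _ _)) (CodeSeq.code (map _ _)) => ps cs psE csE.
rewrite !nthc_code [nth _ _ 0]/= [nth _ _ 1]/= [nth _ _ 2]/=.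
apply/and4P; split.
- by rewrite psE // take0; apply/eqcP.
- by rewrite csE // take0.
- apply/allP => i; rewrite mem_iota => /= lt_i; apply/hasP; exists (nth 0%N w i).
    by rewrite mem_iota; apply: (allP ww); apply: mem_nth.
  rewrite !psE ?(ltnW lt_i) // !csE ?(ltnW lt_i) //; apply/andP; split.
    apply/mulcP; rewrite !mx_codeK (take_nth 0%N) // -cats1 eval_cat {2}/eval /=.
    by rewrite mulmx1.
  have bN : (nth 0%N w i < size (letters n))%N by apply: (allP ww); apply: mem_nth.
  rewrite (take_nth 0%N) // -cats1 run_cat /= tE // run_lt //.
  by apply/allP => b /mem_take /(allP ww).
- by rewrite psE // take_size; apply/eqcP.
Qed.

(** Elements having a word that fixes [c0] form a subgroup, which contains the generators by their
    traces. If it contained [g], the word traced for [g] would fix [c0] as well, since in a good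
    table the end point depends only on the value of the word. *)
Lemma neg_cert_sound y gens (g : SLZ n) :
  neg_cert y (gens_code gens) (mx_code (slz_val g)) -> ~ generated gens g.
Proof.
set c0 := nthc y 2; set t := nthc y 3.
case/and5P => c0m /allP tab_lt /allP rels /allP tgens /andP[/trace_sound[w [ww ew rw]] ng].
have gt : good_table n (nthc y 1) (tabc t).
  split=> [b c bN cm|r c rr cm].
    have := tab_lt b; rewrite mem_iota => /(_ bN)/allP/(_ c).
    by rewrite mem_iota => /(_ cm).
  by have /allP := rels r rr => /(_ c); rewrite mem_iota => /(_ cm)/eqP.
move=> Gg; pose K : set (SLZ n) := fun x =>
  exists u, [/\ is_word n u, eval n u = x & run (tabc t) c0 u = c0].
have [u [wu eu ru]] : K g.
  apply: Gg; split; first split.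
  - by exists [::].
  - move=> _ _ [u [wu <- ru]] [v [wv <- rv]]; exists (u ++ v).
    by rewrite is_word_cat wu wv eval_cat run_cat ru.
  - move=> _ [u [wu <- ru]]; have [wv ev] := word_invP wu; exists (word_inv n u); split=> //.
    rewrite -{1}ru -run_cat (good_table_trivial n_gt0 gt) //; first by rewrite is_word_cat wu.
    by rewrite eval_cat ev mulgV.
  move=> x gx; have [j lt_j ej] := gens_nthc gx.
  have := tgens j; rewrite mem_iota ej => /(_ lt_j); rewrite (negPf (mx_code_neq0 _)) /=.
  by case/andP=> /trace_sound[u [wu eu ru]] /eqP er; exists u; split=> //; apply: etrans ru er.
move/eqP: ng; apply; apply: etrans (esym rw) (etrans _ ru).
by apply: (good_table_eval n_gt0 gt) => //; rewrite ew eu.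
Qed.

Lemma neg_cert_complete gens (g : SLZ n) : finite_index (generated gens) ->
  ~ generated gens g ->
  exists2 y, hdc y = 1%N & neg_cert y (gens_code gens) (mx_code (slz_val g)).
Proof.
move=> fin ng; have grp := generated_group gens.
have [m [tau [c0 [gt c0m runP]]]] := coset_table grp fin.
have /boolp.choice[wd wdP] : forall x, exists w, is_word n w /\ eval n w = x.
  by move=> x; have [w ww ew] := word_exists x; exists w.
pose t := CodeSeq.code [seq CodeSeq.code [seq tau b c | c <- iota 0 m] |
  b <- iota 0 (size (letters n))].
have tE b c : (b < size (letters n))%N -> (c < m)%N -> tabc t b c = tau b c.
  move=> bN cm; rewrite /tabc nthc_code (nth_map 0%N) ?size_iota // nthc_code.
  by rewrite (nth_map 0%N) ?size_iota // !nth_iota.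
have runE w c : is_word n w -> (c < m)%N -> run (tabc t) c w = run tau c w.
  elim: w c => //= b w IHw c /andP[bN ww] cm; rewrite tE // IHw //.
  by case: gt => tau_lt _; apply: tau_lt.
have traceP x : trace t c0 (trace_code tau c0 (wd x)) (mx_code (slz_val x)).
  have [ww ew] := wdP x; rewrite -{2}ew.
  exact: (trace_complete gt tE).
exists (CodeSeq.code [:: 1%N; m; c0; t; CodeSeq.code [seq trace_code tau c0 (wd x) | x <- gens];
  trace_code tau c0 (wd g)]); first by rewrite hdc_code.
rewrite /neg_cert !nthc_code ![nth _ _ _]/=; apply/and5P; split=> //.
- apply/allP => b; rewrite mem_iota => /= bN; apply/allP => c; rewrite mem_iota => /= cm.
  by rewrite tE //; case: gt => tau_lt _; apply: tau_lt.
- apply/allP => r rr; apply/allP => c; rewrite mem_iota => /= cm.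
  case: gt => _ /(_ r c rr cm) tr; rewrite runE ?tr //.
  by move: rr; rewrite mem_relators => /and3P[].
- apply/allP => i _; case: eqP => //= /eqP; rewrite /gens_code nthc_code => nz.
  have lt_i : (i < size gens)%N.
    by rewrite ltnNge; apply: contra nz => le; rewrite nth_default ?size_map.
  rewrite (nth_map 1%g) // nthc_code (nth_map 1%g) // traceP tend_trace_code.
  have [ww ew] := wdP (nth 1%g gens i); apply/runP => //; rewrite ew.
  by apply: generated_in; apply: mem_nth.
- rewrite traceP tend_trace_code; have [ww ew] := wdP g.
  by apply/negP => /runP; rewrite ew => /(_ ww).
Qed.

End Codes.

Theorem proposition3p2 (n : nat) (hn : (3 <= n)%N) :
  exists f : recfun 2,
    forall (gens : seq (SLZ n)) (g : SLZ n),
      finite_index (generated gens) ->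
      exists b : bool,
        computes f [tuple gens_code gens; mx_code g] b /\
        (b = true <-> generated gens g).
Proof.
have n_gt0 : (0 < n)%N by apply: leq_trans hn.
have [f fP] := rec_decide (rec_check n); exists f => gens g fin.
have [|y] := fP (gens_code gens) (mx_code g).
  (* The classical case distinction only shows that the search halts; the answer is read off the
     certificate found and justified by soundness. *)
  have [/(pos_cert_complete n_gt0)|/(neg_cert_complete n_gt0 fin)] :=
    pselect (generated gens g); by case=> y hy cy; exists y; rewrite /check hy.
rewrite /check => chk fy; exists (hdc y == 0%N); split=> //; move: chk.
case: eqP => _ chk; split=> //; first by move=> _; apply: pos_cert_sound chk.
by move/(neg_cert_sound n_gt0 chk).
Qed.
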